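(* Let $k$ be a field of characteristic $p>0$, let $q>1$ be a power of $p$, let $H$ be a finite $p$-group such that $kH$ has non-finite representation type, and let $G=H\times C_q$, where $C_q$ is a cyclic group of order $q$. Let $M$ be an indecomposable $kH$-module of countable dimension over $k$. Suppose that $w$ is a finite dimensional $kG$-module with $\mathrm{vtx}(w)\leq_G H$, and suppose that $\mathrm{Res}^G_H(w)\otimes_k M$ is not pure projective. Then $\mathrm{stmod}_w(kG)$ does not generate $\mathrm{StMod}_w(kG)$.
   Context: $\mathrm{Mod}(kG)$ is the category of all $kG$-modules and $\mathrm{mod}(kG)$ is the full subcategory of finite dimensional ones. Tensor products of modules are over $k$ with the diagonal group action. For a finite dimensional $kG$-module $w$, $\mathcal{P}(w)$ denotes the smallest additive (full) subcategory of $\mathrm{Mod}(kG)$ that contains $w$ and is closed under tensoring with an arbitrary $kG$-module and under arbitrary direct sums and direct summands. Objects of $\mathcal{P}(w)$ are called $w$-projective. The class of short exact sequences in $\mathrm{Mod}(kG)$ that split when tensored with $w$ is an exact structure whose projective objects and injective objects are both exactly $\mathcal{P}(w)$, with enough of both. The resulting triangulated quotients are $\mathrm{StMod}_w(kG):=\mathrm{Mod}(kG)/\mathcal{P}(w)$ and $\mathrm{stmod}_w(kG):=\mathrm{mod}(kG)/(\mathcal{P}(w)\cap \mathrm{mod}(kG))$: the objects are the same as those of the original category, and morphisms are module homomorphisms modulo those factoring through a $w$-projective module. $\mathrm{stmod}_w(kG)$ is regarded as a full subcategory of $\mathrm{StMod}_w(kG)$. If $\mathcal{S}\subset\mathcal{T}$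 are triangulated categories, $\mathcal{S}$ generates $\mathcal{T}$ if, for every object $X$ of $\mathcal{T}$, $\mathrm{Hom}_{\mathcal{T}}(S,X)=0$ for all $S\in\mathcal{S}$ implies $X\cong 0$. For a subgroup $K\le G$, a $kG$-module is $K$-projective (projective with respect to $K$) if it is a direct summand of $\mathrm{Ind}_K^G(V)$ for some $kK$-module $V$. A vertex $\mathrm{vtx}(w)$ of $w$ is a subgroup $Q$ of $G$ minimal with the property that $w$ is $Q$-projective (unique up to $G$-conjugacy when $w$ is indecomposable). $Q\leq_G H$ means that some $G$-conjugate of $Q$ is contained in $H$. A module is pure projective if it is a direct summand of a direct sum of finite dimensional modules. $kH$ has non-finite representation type if it has infinitely many isomorphism classes of finite dimensional indecomposable modules. *)

(* Defs.v *)
(* The classical layer (boolp, classical_sets, cardinality) is needed because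
   modules have arbitrary dimension; {freeg K / k}, from multinomials, is the
   free k-vector space on K. *)
From HB Require Import structures.
From mathcomp Require Import all_boot all_order all_algebra.
From mathcomp Require Import all_fingroup all_solvable.
From mathcomp Require Import boolp classical_sets functions cardinality.
From mathcomp Require Import freeg.

Set Implicit Arguments.
Unset Strict Implicit.
Unset Printing Implicit Defensive.

Import GRing.Theory.

Local Open Scope quotient_scope.
Local Open Scope classical_set_scope.
Local Open Scope ring_scope.

Section Span.
Variables (k : fieldType) (V : lmodType k).

Definition subspace (U : set V) : Prop :=
  U 0 /\ forall (a : k) u v, U u -> U v -> U (a *: u + v).

Definition span (A : set V) : {pred V} :=
  fun v => `[< forall U : set V, subspace U -> A `<=` U -> U v >].

Lemma spanP (A : set V) v :
  reflect (forall U : set V, subspace U -> A `<=` U -> U v) (v \in span A).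
Proof. exact: asboolP. Qed.

Lemma span_submod_closed A : submod_closed (span A).
Proof.
split=> [|a u v /spanP uA /spanP vA]; apply/spanP => U sU sAU.
  by case: sU.
by have [_ clU] := sU; apply: clU; [exact: uA | exact: vA].
Qed.

HB.instance Definition _ A :=
  GRing.isSubmodClosed.Build k V (span A) (span_submod_closed A).

Lemma mem_span (A : set V) v : A v -> v \in span A.
Proof. by move=> Av; apply/spanP => U _; apply. Qed.

(* V modulo the subspace spanned by A. *)
Definition lquot (A : set V) := Quotient.quot (span A).

Section LQuot.
Variable A : set V.

HB.instance Definition _ := GRing.Zmodule.on (lquot A).

Definition lpi (v : V) : lquot A := \pi_(Quotient.quot (span A)) v.

Lemma lpiP u v : lpi u = lpi v <-> u - v \in span A.
Proof.
by rewrite Quotient.idealrBE; split=> [uv|/eqP//]; apply/eqP; exact: uv.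
Qed.

Definition lrepr (x : lquot A) : V :=
  generic_quotient.repr (x : Quotient.quot (span A)).

Lemma lreprK : cancel lrepr lpi.
Proof. exact: reprK. Qed.

Definition lscale (a : k) (x : lquot A) : lquot A := lpi (a *: lrepr x).

Lemma lscale_pi a v : lscale a (lpi v) = lpi (a *: v).
Proof. by apply/lpiP; rewrite -scalerBr rpredZ //; apply/lpiP/lreprK. Qed.

Lemma lpiD u v : lpi (u + v) = lpi u + lpi v.
Proof. by rewrite /lpi [LHS]raddfD. Qed.

Lemma lscaleA a b x : lscale a (lscale b x) = lscale (a * b) x.
Proof. by rewrite -[x]lreprK !lscale_pi scalerA. Qed.

Lemma lscale1 : left_id 1 lscale.
Proof. by move=> x; rewrite -[x]lreprK lscale_pi scale1r. Qed.

Lemma lscaleDr : right_distributive lscale +%R.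
Proof.
by move=> a x y; rewrite -[x]lreprK -[y]lreprK -lpiD !lscale_pi scalerDr lpiD.
Qed.

Lemma lscaleDl x : {morph lscale^~ x : a b / a + b}.
Proof. by move=> a b; rewrite -[x]lreprK !lscale_pi scalerDl lpiD. Qed.

HB.instance Definition _ := GRing.Zmodule_isLmodule.Build k (lquot A)
  lscaleA lscale1 lscaleDr lscaleDl.

Lemma lpi_is_linear : linear lpi.
Proof. by move=> a u v; rewrite lpiD -lscale_pi. Qed.

HB.instance Definition _ := GRing.isLinear.Build k V (lquot A) _ lpi
  lpi_is_linear.

End LQuot.

Variables (W : lmodType k) (A : set V) (f : {linear V -> W}).
Hypothesis fA : forall v, A v -> f v = 0.

Lemma span_ker v : v \in span A -> f v = 0.
Proof.
move/spanP/(_ [set u | f u = 0]); apply=> [|u /fA//]; split=> [|a u u' fu fu'] /=.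
  exact: linear0.
by rewrite linearP fu fu' scaler0 addr0.
Qed.

Definition lquot_lift of (forall v, A v -> f v = 0) : lquot A -> W :=
  fun x => f (lrepr x).

Lemma lquot_liftE v : lquot_lift fA (lpi A v) = f v.
Proof.
apply/eqP; rewrite -subr_eq0 -linearB; apply/eqP/span_ker/lpiP.
exact: lreprK.
Qed.

Lemma lquot_lift_is_linear : linear (lquot_lift fA).
Proof.
move=> a x y; rewrite -[x]lreprK -[y]lreprK -linearP !lquot_liftE.
exact: linearP.
Qed.

HB.instance Definition _ := GRing.isLinear.Build k (lquot A) W _
  (lquot_lift fA) lquot_lift_is_linear.

End Span.

Lemma lquot_ext (k : fieldType) (V W : lmodType k) (A : set V)
    (f g : lquot A -> W) :
  (forall v, f (lpi A v) = g (lpi A v)) -> f =1 g.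
Proof. by move=> fg x; rewrite -[x]lreprK. Qed.

Lemma fglift_linear (k : fieldType) (K : choiceType) (U : lmodType k)
  (f : K -> U) : linear (fglift f : {freeg K / k} -> U).
Proof.
pose fA := GRing.isZmodMorphism.Build _ _ _ (lift_is_additive f).
pose h : {additive {freeg K / k} -> U} := HB.pack (fglift f) fA.
move=> a x y; rewrite -![fglift f _]/(h _) raddfD; congr (_ + _).
transitivity (h (\sum_(z <- dom x) << a * coeff z x *g z >>)); first by [].
rewrite raddf_sum -{3}[x]freeg_sumE raddf_sum scaler_sumr /=.
by apply: eq_bigr => z _; rewrite !liftU scalerA.
Qed.

Section Tensor.
Variables (k : fieldType) (V W : lmodType k).

Let F := {freeg (V * W)%type / k}.
Let gen (v : V) (w : W) : F := << (v, w) >>.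

Variant tensor_rel : F -> Prop :=
| TensorL a u v w :
    tensor_rel (gen (a *: u + v) w - (a *: gen u w + gen v w))
| TensorR a v u w :
    tensor_rel (gen v (a *: u + w) - (a *: gen v u + gen v w)).

Definition tensor := lquot (tensor_rel : set F).
HB.instance Definition _ := GRing.Lmodule.on tensor.

Definition tmul (v : V) (w : W) : tensor := lpi tensor_rel (gen v w).

Lemma tmulPl w : linear (tmul^~ w).
Proof.
move=> a u v; rewrite /tmul -linearP; apply/lpiP/mem_span.
exact: TensorL.
Qed.

Lemma tmulPr v : linear (tmul v).
Proof.
move=> a u w; rewrite /tmul -linearP; apply/lpiP/mem_span.
exact: TensorR.
Qed.

Section Lift.
Variables (U : lmodType k) (b : V -> W -> U).
Hypothesis b_l : forall w, linear (b^~ w).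
Hypothesis b_r : forall v, linear (b v).

Definition tlift_free : F -> U := fglift (fun vw => b vw.1 vw.2).

Lemma tlift_free_gen v w : tlift_free (gen v w) = b v w.
Proof. by rewrite /tlift_free liftU scale1r. Qed.

HB.instance Definition _ := GRing.isLinear.Build k F U _ tlift_free (fglift_linear _).

Lemma tlift_free_rel x : tensor_rel x -> tlift_free x = 0.
Proof.
by case=> *; rewrite linearB linearP /= !tlift_free_gen ?b_l ?b_r subrr.
Qed.

Definition tlift : tensor -> U := lquot_lift tlift_free_rel.

Lemma tliftE v w : tlift (tmul v w) = b v w.
Proof. by rewrite /tlift /tmul lquot_liftE; exact: tlift_free_gen. Qed.

Lemma tlift_is_linear : linear tlift.
Proof. exact: linearP. Qed.

HB.instance Definition _ := GRing.isLinear.Build k tensor U _ tlift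
  tlift_is_linear.

End Lift.

Lemma tensor_ext (U : lmodType k) (f g : {linear tensor -> U}) :
  (forall v w, f (tmul v w) = g (tmul v w)) -> f =1 g.
Proof.
move=> fg; apply: lquot_ext => x.
suff sumE (h : {linear tensor -> U}) : h (lpi tensor_rel x) =
    \sum_(z <- dom x) coeff z x *: h (tmul z.1 z.2).
  by rewrite !sumE; apply: eq_bigr => z _; rewrite fg.
rewrite -{1}[x]freeg_sumE.
rewrite (raddf_sum (lpi tensor_rel)) (raddf_sum h); apply: eq_bigr => -[v w] _.
rewrite -linearZ /tmul -linearZ; congr (h (lpi _ _)).
by apply/eqP/freeg_eqP => t; rewrite coeffZ !coeffU mul1r.
Qed.

End Tensor.

Section TensorMap.
Variables (k : fieldType) (V W V' W' : lmodType k).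
Variables (f : {linear V -> V'}) (g : {linear W -> W'}).

Lemma tmap_subproofl w : linear (fun v => tmul (f v) (g w)).
Proof. by move=> a u v; rewrite linearP tmulPl. Qed.

Lemma tmap_subproofr v : linear (fun w => tmul (f v) (g w)).
Proof. by move=> a u w; rewrite linearP tmulPr. Qed.

Definition tmap : tensor V W -> tensor V' W' :=
  tlift tmap_subproofl tmap_subproofr.

HB.instance Definition _ := GRing.Linear.on tmap.

Lemma tmapE v w : tmap (tmul v w) = tmul (f v) (g w).
Proof. exact: tliftE. Qed.

End TensorMap.

Section DirectSum.
Variables (k : fieldType) (I : Type) (V : I -> lmodType k).

Definition prodmod := forall i, V i.
HB.instance Definition _ := Choice.on prodmod.

Let dzero : prodmod := fun=> 0.
Let dopp (x : prodmod) : prodmod := fun i => - x i.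
Let dadd (x y : prodmod) : prodmod := fun i => x i + y i.
Let dscale (a : k) (x : prodmod) : prodmod := fun i => a *: x i.

Let daddA : associative dadd.
Proof. by move=> x y z; apply: functional_extensionality_dep => i; exact: addrA. Qed.
Let daddC : commutative dadd.
Proof. by move=> x y; apply: functional_extensionality_dep => i; exact: addrC. Qed.
Let dadd0 : left_id dzero dadd.
Proof. by move=> x; apply: functional_extensionality_dep => i; exact: add0r. Qed.
Let daddN : left_inverse dzero dopp dadd.
Proof. by move=> x; apply: functional_extensionality_dep => i; exact: addNr. Qed.

HB.instance Definition _ := GRing.isZmodule.Build prodmod daddA daddC dadd0 daddN.

Let dscaleA a b x : dscale a (dscale b x) = dscale (a * b) x.
Proof. by apply: functional_extensionality_dep => i; exact: scalerA. Qed.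
Let dscale1 : left_id 1 dscale.
Proof. by move=> x; apply: functional_extensionality_dep => i; exact: scale1r. Qed.
Let dscaleDr : right_distributive dscale +%R.
Proof. by move=> a x y; apply: functional_extensionality_dep => i; exact: scalerDr. Qed.
Let dscaleDl x : {morph dscale^~ x : a b / a + b}.
Proof. by move=> a b; apply: functional_extensionality_dep => i; exact: scalerDl. Qed.

HB.instance Definition _ := GRing.Zmodule_isLmodule.Build k prodmod
  dscaleA dscale1 dscaleDr dscaleDl.

Definition fin_supp : {pred prodmod} :=
  fun x => `[< finite_set [set i | x i <> 0] >].

Lemma fin_suppP (x : prodmod) :
  reflect (finite_set [set i | x i <> 0]) (x \in fin_supp).
Proof. exact: asboolP. Qed.

Lemma fin_supp_submod_closed : submod_closed fin_supp.
Proof.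
split=> [|a x y /fin_suppP fx /fin_suppP fy]; apply/fin_suppP.
  by apply: sub_finite_set (@finite_set0 I) => i /=.
have := conj fx fy; rewrite -finite_setU; apply: sub_finite_set => i /= xy_i.
apply: contrapT => /not_orP[/contrapT xi /contrapT yi]; apply: xy_i.
by rewrite [LHS](_ : _ = a *: x i + y i) // xi yi scaler0 addr0.
Qed.

HB.instance Definition _ :=
  GRing.isSubmodClosed.Build k prodmod fin_supp fin_supp_submod_closed.

Record dsum := DSum { dsum_val : prodmod; dsum_fin : dsum_val \in fin_supp }.
HB.instance Definition _ := [isSub for dsum_val].
HB.instance Definition _ := [Choice of dsum by <:].
HB.instance Definition _ := [SubChoice_isSubLmodule of dsum by <:].

Definition dcoord (x : dsum) (i : I) : V i := dsum_val x i.

Lemma dsum_ext (x y : dsum) : (forall i, dcoord x i = dcoord y i) -> x = y.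
Proof. by move=> xy; apply/val_inj/functional_extensionality_dep. Qed.

Lemma dcoordP (a : k) (x y : dsum) i :
  dcoord (a *: x + y) i = a *: dcoord x i + dcoord y i.
Proof. by []. Qed.

End DirectSum.

Section DirectSumMap.
Variables (k : fieldType) (I : Type) (V W : I -> lmodType k).
Variable f : forall i, {linear V i -> W i}.

Lemma dsum_map_subproof (x : dsum V) :
  ((fun i => f i (dcoord x i)) : prodmod W) \in @fin_supp k I W.
Proof.
have /fin_suppP fx := dsum_fin x; apply/fin_suppP; apply: sub_finite_set fx => i /= fxi xi.
by apply: fxi; rewrite /dcoord xi linear0.
Qed.

Definition dsum_map (x : dsum V) : dsum W := DSum (dsum_map_subproof x).

Lemma dsum_map_is_linear : linear dsum_map.
Proof.
by move=> a x y; apply: dsum_ext => i; rewrite dcoordP [LHS]linearP.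
Qed.

HB.instance Definition _ := GRing.isLinear.Build k (dsum V) (dsum W) _
  dsum_map dsum_map_is_linear.

End DirectSumMap.

Definition findim (k : fieldType) (V : lmodType k) : Prop :=
  exists n : nat, inhabited (Vector.axiom n V).

Definition lin_indep (k : fieldType) (V : lmodType k) (B : set V) : Prop :=
  forall (s : seq V) (c : V -> k), uniq s -> {in s, forall v, B v} ->
    \sum_(v <- s) c v *: v = 0 -> {in s, forall v, c v = 0}.

Definition lin_basis (k : fieldType) (V : lmodType k) (B : set V) : Prop :=
  lin_indep B /\ forall v, v \in span B.

Definition countable_dim (k : fieldType) (V : lmodType k) : Prop :=
  exists B : set V, lin_basis B /\ countable B.

(* kG-modules are k-linear representations of G, of any dimension.
   As for mx_representation, the action is a total function on gT, but only its
   values on G are constrained, and only these are ever used to compare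
   modules; a kG-module thus restricts to a subgroup by keeping the same data. *)

Record gmod (k : fieldType) (gT : finGroupType) (G : {group gT}) := GMod {
  gcarrier :> lmodType k;
  gact : gT -> {linear gcarrier -> gcarrier};
  gact1 : forall v, gact 1%g v = v;
  gactM : forall x y, x \in G -> y \in G ->
    forall v, gact (x * y)%g v = gact x (gact y v)
}.

Section GModTheory.
Variables (k : fieldType) (gT : finGroupType).
Implicit Types G K : {group gT}.

Definition ghom G (X Y : gmod k G) (f : {linear X -> Y}) : Prop :=
  forall x, x \in G -> forall v, f (gact X x v) = gact Y x (f v).

Definition giso G (X Y : gmod k G) : Prop :=
  exists2 f : {linear X -> Y}, ghom f & bijective f.

Definition gzero G : gmod k G.
Proof. by exists 'rV[k]_0 (fun=> idfun). Defined.

Section Sum2.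
Variables (G : {group gT}) (X Y : gmod k G).

Definition gsum2_act (x : gT) (u : X * Y) : X * Y :=
  (gact X x u.1, gact Y x u.2).

Lemma gsum2_act_is_linear x : linear (gsum2_act x).
Proof. by move=> a u v; rewrite /gsum2_act !linearP. Qed.

HB.instance Definition _ x := GRing.isLinear.Build k (X * Y)%type (X * Y)%type _
  (gsum2_act x) (gsum2_act_is_linear x).

Definition gsum2 : gmod k G.
Proof.
exists (X * Y)%type (fun x => gsum2_act x) => [[u v]|x y Gx Gy [u v]].
  by rewrite /= /gsum2_act !gact1.
by rewrite /= /gsum2_act !gactM.
Defined.

End Sum2.

Definition gdsum G (I : Type) (X : I -> gmod k G) : gmod k G.
Proof.
exists (dsum X) (fun x => dsum_map (fun i => gact (X i) x)) => [u|x y Gx Gy u].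
  by apply: dsum_ext => i; exact: gact1.
by apply: dsum_ext => i; exact: gactM.
Defined.

Definition gtensor G (X Y : gmod k G) : gmod k G.
Proof.
exists (tensor X Y) (fun x => tmap (gact X x) (gact Y x)) => [|x y Gx Gy].
  by apply: (tensor_ext (g := idfun)) => u v; rewrite /= tmapE !gact1.
pose h := tmap (gact X x) (gact Y x) \o tmap (gact X y) (gact Y y).
by apply: (tensor_ext (g := h)) => u v; rewrite /= !tmapE !gactM.
Defined.

Definition gres G K (sKG : K \subset G) (X : gmod k G) : gmod k K.
Proof.
exists X (gact X) => [|x y Kx Ky]; first exact: gact1.
by apply: gactM; exact: (fintype.subsetP sKG).
Defined.

(* Ind_K^G X = kG (x)_{kK} X, presented as the quotient of
   kG (x)_k X = {ffun [subg G] -> X} by the relations xh (x) v - x (x) hv; the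
   elementary tensor x (x) v is gdelta x v. [subg G] is G as a type, and subg G
   is the projection onto it, the identity on G. Meant for K \subset G. *)
Section Induction.
Variables (G K : {group gT}) (X : gmod k K).

Let kGX := {ffun [subg G] -> X}.

Definition gdelta (x : [subg G]) (v : X) : kGX :=
  [ffun y => if y == x then v else 0].

Variant ind_rel : kGX -> Prop :=
  IndRel x h v of h \in K :
    ind_rel (gdelta (x * subg G h)%g v - gdelta x (gact X h v)).

Definition gshift (x : [subg G]) (u : kGX) : kGX :=
  [ffun y => u (x^-1 * y)%g].

Lemma gshift_is_linear x : linear (gshift x).
Proof. by move=> a u v; apply/ffunP => y; rewrite !ffunE. Qed.

HB.instance Definition _ x := GRing.isLinear.Build k kGX kGX _
  (gshift x) (gshift_is_linear x).

Lemma gshift_delta x y v : gshift x (gdelta y v) = gdelta (x * y)%g v.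
Proof.
apply/ffunP => z; rewrite !ffunE; congr (if _ then _ else _).
by apply/eqP/eqP => [<-|->]; rewrite ?mulKVg ?mulKg.
Qed.

Lemma gshift_rel x u : ind_rel u -> (lpi ind_rel \o gshift x) u = 0.
Proof.
case=> y h v Kh; rewrite /= linearB /= !gshift_delta mulgA.
rewrite -[RHS](linear0 (lpi ind_rel)); apply/lpiP; rewrite subr0.
exact/mem_span/IndRel.
Qed.

Definition ind_act (x : gT) : lquot ind_rel -> lquot ind_rel :=
  lquot_lift (gshift_rel (subg G x)).

HB.instance Definition _ x := GRing.Linear.on (ind_act x).

Definition gind : gmod k G.
Proof.
exists (lquot ind_rel) (fun x => ind_act x) => [|x y Gx Gy].
  apply: lquot_ext => u; rewrite /= /ind_act lquot_liftE /=; congr lpi.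
  by apply/ffunP => z; rewrite ffunE (morph1 (subg G)) invg1 mul1g.
apply: lquot_ext => u; rewrite /= /ind_act !lquot_liftE /=; congr lpi.
apply/ffunP => z; rewrite !ffunE morphM //.
by rewrite invMg mulgA.
Defined.

End Induction.

Definition gsummand G (X Y : gmod k G) : Prop :=
  exists Z : gmod k G, giso Y (gsum2 X Z).

Definition indecomposable G (X : gmod k G) : Prop :=
  ~ giso X (gzero G) /\
  forall Y Z : gmod k G, giso X (gsum2 Y Z) ->
    giso Y (gzero G) \/ giso Z (gzero G).

Definition finite_rep_type G : Prop :=
  exists (n : nat) (F : 'I_n -> gmod k G),
    forall X : gmod k G, findim X -> indecomposable X -> exists i, giso X (F i).

Definition pure_projective G (X : gmod k G) : Prop :=
  exists (I : Type) (F : I -> gmod k G),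
    (forall i, findim (F i)) /\ gsummand X (gdsum F).

Definition rel_projective G K (X : gmod k G) : Prop :=
  exists Y : gmod k K, gsummand X (gind G Y).

Definition is_vertex G (X : gmod k G) (Q : {group gT}) : Prop :=
  [/\ Q \subset G, rel_projective Q X &
      forall R : {group gT}, R \subset Q -> rel_projective R X -> R = Q].

Definition conj_sub G Q K : Prop := exists2 x, x \in G & (Q :^ x \subset K)%g.

(* The zero object is the empty direct sum, and closure under isomorphism is
   closure under direct summands (with zero complement). *)
Inductive wproj G (w : gmod k G) : gmod k G -> Prop :=
| WprojBase : wproj w w
| WprojTensor X Y : wproj w X -> wproj w (gtensor X Y)
| WprojSum (I : Type) (F : I -> gmod k G) :
    (forall i, wproj w (F i)) -> wproj w (gdsum F)
| WprojSummand X Y : wproj w Y -> gsummand X Y -> wproj w X.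

(* f and g become equal in StMod_w(kG): f - g factors through P(w). *)
Definition stable_eq G (w X Y : gmod k G) (f g : X -> Y) : Prop :=
  exists P : gmod k G, wproj w P /\
  exists (a : {linear X -> P}) (b : {linear P -> Y}),
    [/\ ghom a, ghom b & forall v, f v - g v = b (a v)].

Definition stable_iso G (w X Y : gmod k G) : Prop :=
  exists (f : {linear X -> Y}) (g : {linear Y -> X}),
    [/\ ghom f, ghom g, stable_eq w (g \o f) idfun
      & stable_eq w (f \o g) idfun].

(* The objects of stmod_w(kG) are the finite dimensional modules, and its
   morphism sets are those of StMod_w(kG). *)
Definition stmod_generates_StMod G (w : gmod k G) : Prop :=
  forall X : gmod k G,
    (forall S : gmod k G, findim S ->
       forall f : {linear S -> X}, ghom f -> stable_eq w f (fun=> 0)) ->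
    stable_iso w X (gzero G).

End GModTheory.

Lemma dprod_subl (gT : finGroupType) (G H C : {group gT}) :
  (H \x C)%g = G -> H \subset G.
Proof. by case/dprod_normal2 => /normal_sub. Qed.

(* Main.v *)
From HB Require Import structures.
From mathcomp Require Import all_boot all_order all_algebra.
From mathcomp Require Import all_fingroup all_solvable.
From mathcomp Require Import boolp classical_sets cardinality fsbigop.
Require Import Defs.

(** Write W for the restriction of w to H, c for a generator of C, and coind V
    for the kG-module of functions from C to a kH-module V.

    Cover M by the direct sum B of finite dimensional submodules N_r, one for
    each finite sequence r of vectors of M and containing r. The map
    pi : B -> M is a pure epimorphism, and remains one after tensoring with W:
    a homomorphism from a finite dimensional S to W (x) M lands in some
    W (x) N_r, hence lifts to W (x) B (tensor_factor_fd). But W (x) pi does not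
    split over H, for W (x) M would then be a summand of the direct sum of the
    W (x) N_r, and pure projective.

    This failure is turned into an object E of StMod_w(kG) which finite
    dimensional modules do not see: E is the pullback of coind (W (x) pi) along
    the endomorphism c - 1 of coind (W (x) M), where c translates functions on
    C (ext). For A = ker pi, it is an extension of coind (W (x) M) by
    coind (W (x) A). When q = 2, a kG-module is a kH-module with the
    differential c - 1, and E is, up to isomorphism, the three-term exact
    sequence W (x) (A -> B -> M) folded into one differential module: an
    acyclic complex that is pure but does not split.

    A homomorphism S -> E with S finite dimensional is zero in StMod_w(kG). Its
    component S -> coind (W (x) M) is adjoint to a homomorphism S -> W (x) M
    over H; lifting the latter makes S -> E factor through the sum of
    coind (W (x) A) and coind (W (x) B) (ext_factor). Both are w-projective,
    as coind (W (x) Z) is isomorphic to w (x) coind Z (wproj_coind).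

    If E were zero in StMod_w(kG), it would be a retract of a w-projective
    module. As w is projective relative to H, so are all w-projective modules;
    by Higman's criterion the identity of each is a trace from H
    (higman_vertex, higman_wproj). A trace identity on E gives a splitting of
    W (x) pi by summation along C, because #|C| vanishes in k (ext_split). *)

Set Implicit Arguments.
Unset Strict Implicit.
Unset Printing Implicit Defensive.

Import GRing.Theory.
Local Open Scope classical_set_scope.
Local Open Scope ring_scope.

(** * Linear maps, kernels and lifts *)

Section LinearMaps.
Variable k : fieldType.
Implicit Types U V W : lmodType k.

Definition mklin V W (f : V -> W) (lin_f : linear f) : {linear V -> W} :=
  HB.pack f (GRing.isLinear.Build k V W *:%R f lin_f).

Lemma mklinE V W (f : V -> W) (lin_f : linear f) v : mklin lin_f v = f v.
Proof. by []. Qed.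

(** The lift is chosen pointwise; uniqueness of lifts makes it linear. *)
Lemma lift_linear U V W (j : {linear V -> W}) (f : {linear U -> W}) :
    injective j -> (forall u, exists v, j v = f u) ->
  exists g : {linear U -> V}, forall u, j (g u) = f u.
Proof.
move=> inj_j /choice[g jg].
suff lin_g : linear g by exists (mklin lin_g).
by move=> a u v; apply: inj_j; rewrite linearP !jg linearP.
Qed.

Lemma linear_inverse V W (f : {linear V -> W}) : bijective f ->
  exists g : {linear W -> V}, cancel f g /\ cancel g f.
Proof.
move=> bij_f; have [f' f'K fK] := bij_f.
have [|g fg] := @lift_linear W V W f idfun (bij_inj bij_f).
  by move=> u; exists (f' u); rewrite fK.
by exists g; split=> // v; apply: (bij_inj bij_f); rewrite fg.
Qed.

Section Kernel.
Variables (V W : lmodType k) (f : {linear V -> W}).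

Definition in_ker : {pred V} := fun v => f v == 0.

Lemma in_ker_submod_closed : submod_closed in_ker.
Proof.
split=> [|a u v /eqP fu /eqP fv]; apply/eqP; first exact: linear0.
by rewrite linearP fu fv scaler0 addr0.
Qed.

HB.instance Definition _ :=
  GRing.isSubmodClosed.Build k V in_ker in_ker_submod_closed.

Record ker := Ker { ker_val : V; ker_valP : ker_val \in in_ker }.
HB.instance Definition _ := [isSub for ker_val].
HB.instance Definition _ := [Choice of ker by <:].
HB.instance Definition _ := [SubChoice_isSubLmodule of ker by <:].

Lemma ker_val_is_linear : linear (ker_val : ker -> V).
Proof. by []. Qed.

Definition ker_incl : {linear ker -> V} := mklin ker_val_is_linear.

Lemma ker_incl_inj : injective ker_incl.
Proof. exact: val_inj. Qed.

Lemma ker_inclK u : f (ker_incl u) = 0.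
Proof. exact/eqP/(ker_valP u). Qed.

Lemma ker_incl_surj v : f v = 0 -> exists u, ker_incl u = v.
Proof. by move=> /eqP fv; exists (Ker fv). Qed.

End Kernel.

End LinearMaps.

Section Modules.
Variables (k : fieldType) (gT : finGroupType) (G : {group gT}).
Implicit Types X Y Z : gmod k G.

Lemma lift_ghom X Y Z (j : {linear Y -> Z}) (f : {linear X -> Z}) :
    ghom j -> ghom f -> injective j -> (forall x, exists y, j y = f x) ->
  exists2 g : {linear X -> Y}, ghom g & forall x, j (g x) = f x.
Proof.
move=> hj hf inj_j surj_j; have [g jg] := lift_linear inj_j surj_j.
by exists g => // x Gx v; apply: inj_j; rewrite jg hf // hj // jg.
Qed.

Lemma ghom_comp X Y Z (f : {linear X -> Y}) (g : {linear Y -> Z}) :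
  ghom f -> ghom g -> ghom (g \o f).
Proof. by move=> hf hg x Gx v; rewrite /= hf // hg. Qed.

Section Kernel.
Variables (X Y : gmod k G) (f : {linear X -> Y}).
Hypothesis hf : ghom f.

(* Elements outside G need not preserve the kernel; they act trivially. *)
Lemma ker_act_subproof x (u : ker f) :
  gact X (if x \in G then x else 1%g) (ker_val u) \in in_ker f.
Proof. by apply/eqP; rewrite hf ?ker_inclK ?linear0 //; case: ifP. Qed.

Definition ker_act x (u : ker f) : ker f := Ker (ker_act_subproof x u).

Lemma ker_act_is_linear x : linear (ker_act x).
Proof. by move=> a u v; apply: val_inj; exact: linearP. Qed.

Definition gker : gmod k G.
Proof.
exists (ker f) (fun x => mklin (ker_act_is_linear x)) => [u|x y Gx Gy u].
  by apply: val_inj; rewrite /= if_same gact1.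
by apply: val_inj; rewrite /= groupM // Gx Gy gactM.
Defined.

Lemma ghom_ker_incl : @ghom k gT G gker X (ker_incl f).
Proof. by move=> x Gx v; rewrite /= Gx. Qed.

End Kernel.

(** The complement of X is the kernel of the retraction. *)
Lemma gsummand_retract X Y (a : {linear X -> Y}) (b : {linear Y -> X}) :
  ghom a -> ghom b -> cancel a b -> gsummand X Y.
Proof.
move=> ha hb aK; exists (gker hb).
have projP : linear (fun y => y - a (b y)).
  by move=> c u v; rewrite !linearP /= addrACA -scalerDr.
have [|||y|p hp pE] := @lift_ghom Y (gker hb) Y (ker_incl b) (mklin projP).
- exact: ghom_ker_incl.
- by move=> x Gx v; rewrite !mklinE hb // ha // linearB.
- exact: ker_incl_inj.
- by apply: ker_incl_surj; rewrite mklinE linearB /= aK subrr.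
have lin_f : linear (fun y => (b y, p y) : X * gker hb).
  by move=> c u v; rewrite !linearP.
exists (mklin lin_f) => [x Gx v|].
  by rewrite !mklinE hb // hp.
exists (fun u => a u.1 + ker_incl b u.2) => [y|[x z]].
  by rewrite mklinE [LHS]/= [X in _ + X]pE mklinE addrC subrK.
rewrite mklinE [fst _]/= [snd _]/=; have bE : b (a x + ker_incl b z) = x.
  by rewrite linearD aK ker_inclK addr0.
congr (_, _); first exact: bE.
by apply: (@ker_incl_inj _ _ _ b); rewrite pE mklinE bE addrC addKr.
Qed.

Lemma gsummand_split X Y : gsummand X Y ->
  exists (a : {linear X -> Y}) (b : {linear Y -> X}),
    [/\ ghom a, ghom b & cancel a b].
Proof.
case=> Z [f hf /linear_inverse[g [fK gK]]].
have lin1 : linear (fun x : X => (x, 0) : gsum2 X Z).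
  by move=> c u v; congr (_, _); rewrite /= scaler0 addr0.
have lin2 : linear (fun u : gsum2 X Z => u.1) by [].
exists (g \o mklin lin1), (mklin lin2 \o f); split=> [x Gx v|x Gx v|x] /=.
- by apply: (can_inj fK); rewrite gK hf // gK /= /gsum2_act /= linear0.
- by rewrite hf.
- by rewrite gK.
Qed.

End Modules.

(** * Tensoring with a finite dimensional space *)

Section FiniteCoordinates.
Variables (k : fieldType) (W : lmodType k).

Definition dual_bases n (e : 'I_n -> W) (c : 'I_n -> {linear W -> k^o}) :=
  (forall u, u = \sum_j c j u *: e j) /\ (forall i j, c j (e i) = (i == j)%:R).

Lemma findim_dual_bases : findim W ->
  exists n (e : 'I_n -> W) (c : 'I_n -> {linear W -> k^o}), dual_bases e c.
Proof.
case=> n [[v2r lin_v2r /(@linear_inverse _ _ _ (mklin lin_v2r))[r2v [vK rK]]]].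
have lin_c j : linear (fun u => v2r u 0 j : k^o).
  by move=> a u v; rewrite lin_v2r !mxE.
exists n, (fun j => r2v (delta_mx 0 j)), (fun j => mklin (lin_c j)).
split=> [u|i j].
  rewrite -[LHS]vK [mklin _ u]row_sum_delta linear_sum; apply: eq_bigr => j _.
  by rewrite linearZ.
by rewrite mklinE -[v2r _]/(mklin lin_v2r _) rK mxE eqxx eq_sym.
Qed.

End FiniteCoordinates.

Section TensorMaps.
Variable k : fieldType.
Implicit Types U V W : lmodType k.

Lemma tmul0r V W (v : V) : tmul v (0 : W) = 0.
Proof. exact: linear0 (mklin (tmulPr v)). Qed.

Lemma tmulZ V W a (v : V) (u : W) : tmul (a *: v) u = tmul v (a *: u).
Proof.
transitivity (a *: tmul v u); first exact: (linearZ_LR (mklin (tmulPl u)) a v).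
exact/esym/(linearZ_LR (mklin (tmulPr v)) a u).
Qed.

Lemma tmul_suml V W (I : Type) (r : seq I) (v : I -> V) (u : W) :
  tmul (\sum_(i <- r) v i) u = \sum_(i <- r) tmul (v i) u.
Proof. exact: linear_sum (mklin (tmulPl u)) _ _ _ _. Qed.

Lemma tmap_comp V V' V'' W W' W'' (f : {linear V -> V'}) (g : {linear W -> W'})
    (f' : {linear V' -> V''}) (g' : {linear W' -> W''})
    (f'' : {linear V -> V''}) (g'' : {linear W -> W''}) t :
  (forall v, f' (f v) = f'' v) -> (forall v, g' (g v) = g'' v) ->
  tmap f' g' (tmap f g t) = tmap f'' g'' t.
Proof.
move=> ff gg; move: t.
apply: (tensor_ext (f := tmap f' g' \o tmap f g) (g := tmap f'' g'')) => v w /=.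
by rewrite !tmapE ff gg.
Qed.

Lemma tmap_id V W (f : {linear V -> V}) (g : {linear W -> W}) t :
  f =1 id -> g =1 id -> tmap f g t = t.
Proof.
move=> fE gE; move: t; apply: (tensor_ext (f := tmap f g) (g := idfun)) => v w.
by rewrite /= tmapE fE gE.
Qed.

Lemma tmap_0r V V' W W' (f : {linear V -> V'}) (g : {linear W -> W'}) t :
  (forall v, g v = 0) -> tmap f g t = 0.
Proof.
move=> gE; move: t; apply: (tensor_ext (f := tmap f g) (g := \0)) => v w.
by rewrite /= tmapE gE tmul0r.
Qed.

Lemma ghom_tmap (gT : finGroupType) (G : {group gT}) (X X' Y Y' : gmod k G)
    (f : {linear X -> X'}) (g : {linear Y -> Y'}) :
  ghom f -> ghom g -> @ghom _ _ _ (gtensor X Y) (gtensor X' Y') (tmap f g).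
Proof.
move=> hf hg x Gx t /=.
rewrite (tmap_comp (f'' := f \o gact X x) (g'' := g \o gact Y x)) //.
by apply/esym/tmap_comp => v /=; rewrite (hf, hg).
Qed.

(** A dual basis of W identifies W (x) V with V^n, naturally in V. Exactness
    of W (x) - is read off coordinate by coordinate, without choosing bases of
    the infinite dimensional factors. *)
Section Coordinates.
Variables (W : lmodType k) (n : nat) (e : 'I_n -> W).
Variable c : 'I_n -> {linear W -> k^o}.
Hypothesis ec : dual_bases e c.

Section TCoord.
Variables (V : lmodType k) (j : 'I_n).

Lemma tcoord_linl (v : V) : linear (fun u : W => (c j u : k) *: v).
Proof. by move=> a u u'; rewrite linearP scalerDl scalerA. Qed.

Lemma tcoord_linr u : linear (fun v : V => (c j u : k) *: v).
Proof. by move=> a v v'; rewrite scalerDr !scalerA mulrC. Qed.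

Definition tcoord : {linear tensor W V -> V} := tlift tcoord_linl tcoord_linr.

Lemma tcoord_tmul u v : tcoord (tmul u v) = (c j u : k) *: v.
Proof. exact: tliftE. Qed.

End TCoord.

Lemma tcoord_map V V' (g : {linear V -> V'}) j t :
  tcoord V' j (tmap idfun g t) = g (tcoord V j t).
Proof.
move: t; apply: (tensor_ext (f := tcoord V' j \o tmap idfun g)
  (g := g \o tcoord V j)) => u v.
by rewrite /= tmapE !tcoord_tmul linearZ_LR.
Qed.

Lemma tcoord_sum V t : t = \sum_j tmul (e j) (tcoord V j t).
Proof.
have lin_s : linear (fun t => \sum_j tmul (e j) (tcoord V j t)).
  move=> a x y; rewrite scaler_sumr -big_split; apply: eq_bigr => j _.
  by rewrite linearP tmulPr.
move: t; apply: (tensor_ext (f := idfun) (g := mklin lin_s)) => u v.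
suff: tmul u v = \sum_j tmul (e j) (tcoord V j (tmul u v)) by [].
transitivity (tmul (\sum_j (c j u : k) *: e j) v); first by rewrite -(proj1 ec).
rewrite tmul_suml; apply: eq_bigr => j _.
by rewrite tcoord_tmul tmulZ.
Qed.

Lemma tcoord_ext V (t t' : tensor W V) :
  (forall j, tcoord V j t = tcoord V j t') -> t = t'.
Proof.
move=> tt'; rewrite (tcoord_sum t) (tcoord_sum t').
by under eq_bigr do rewrite tt'.
Qed.

Lemma tcoord_lift V V' (g : {linear V -> V'}) t :
  (forall j, exists v, g v = tcoord V' j t) -> exists t', tmap idfun g t' = t.
Proof.
move=> /choice[v gv]; exists (\sum_j tmul (e j) (v j)).
rewrite linear_sum [RHS]tcoord_sum; apply: eq_bigr => j _.
by rewrite /= tmapE gv.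
Qed.

Lemma tcoord_of_sum V (v : 'I_n -> V) j :
  tcoord V j (\sum_i tmul (e i) (v i)) = v j.
Proof.
rewrite linear_sum (bigD1 j) //= tcoord_tmul (proj2 ec) eqxx scale1r.
rewrite big1 ?addr0 // => i ij.
by rewrite tcoord_tmul (proj2 ec) (negPf ij) scale0r.
Qed.

End Coordinates.

Lemma tmap_inj V V' W (g : {linear V -> V'}) :
  findim W -> injective g -> injective (tmap (@idfun W) g).
Proof.
move=> /findim_dual_bases[n [e [c ec]]] inj_g t t' tt'.
by apply: (tcoord_ext ec) => j; apply: inj_g; rewrite -!(tcoord_map c) tt'.
Qed.

Lemma tmap_exact V V' V'' W (i : {linear V -> V'}) (g : {linear V' -> V''}) t :
    findim W -> (forall v, g v = 0 -> exists u, i u = v) ->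
  tmap (@idfun W) g t = 0 -> exists t', tmap (@idfun W) i t' = t.
Proof.
move=> /findim_dual_bases[n [e [c ec]]] ex_ig gt0.
by apply: (tcoord_lift ec) => j; apply: ex_ig; rewrite -tcoord_map gt0 linear0.
Qed.

Lemma findim_tensor V W : findim W -> findim V -> findim (tensor W V).
Proof.
move=> /findim_dual_bases[n [e [c ec]]].
case=> d [[v2r lin_v2r /(@linear_inverse _ _ _ (mklin lin_v2r))[r2v [vK rK]]]].
exists (n * d)%N; constructor.
pose phi (t : tensor W V) := mxvec (\matrix_j v2r (tcoord c V j t)).
exists phi.
  move=> a t t'; rewrite /phi -linearP; congr mxvec; apply/row_matrixP => j.
  by rewrite [RHS]linearP /= !rowK linearP lin_v2r.
exists (fun r => \sum_j tmul (e j) (r2v (row j (vec_mx r)))) => [t|r].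
  rewrite [RHS](tcoord_sum ec); apply: eq_bigr => j _.
  by rewrite mxvecK rowK [r2v _]vK.
rewrite -[RHS]vec_mxK; congr mxvec; apply/row_matrixP => j.
by rewrite rowK (tcoord_of_sum ec) [v2r _]rK.
Qed.

End TensorMaps.

(** * Maps out of direct sums *)

Section DirectSumMaps.
Variables (k : fieldType) (I : choiceType) (V : I -> lmodType k).

Lemma din_subproof i (v : V i) :
  (dfwith (fun j => 0) v : prodmod V) \in @fin_supp k I V.
Proof.
apply/fin_suppP/(sub_finite_set _ (finite_set1 i)) => j /= vj.
by apply: contrapT => /eqP ji; apply: vj; rewrite dfwith_out // eq_sym.
Qed.

Lemma din_is_linear i : linear (fun v : V i => DSum (din_subproof v)).
Proof.
move=> a u v; apply: dsum_ext => j; rewrite dcoordP /dcoord /=.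
have [<-|ij] := eqVneq i j; first by rewrite !dfwith_in.
by rewrite !dfwith_out // scaler0 addr0.
Qed.

Definition din i : {linear V i -> dsum V} := mklin (@din_is_linear i).

Lemma dcoord_in i v : dcoord (din i v) i = v.
Proof. exact: dfwith_in. Qed.

Lemma dcoord_out i j v : i != j -> dcoord (din i v) j = 0.
Proof. exact: dfwith_out. Qed.

Definition dsupp (x : dsum V) : set I := [set i | dcoord x i <> 0].

Lemma finite_dsupp x : finite_set (dsupp x).
Proof. exact/fin_suppP/dsum_fin. Qed.

Section Lift.
Variables (W : lmodType k) (h : forall i, {linear V i -> W}).

Definition dlift_fun (x : dsum V) : W := \sum_(i \in dsupp x) h i (dcoord x i).

Lemma dlift_widen (D : set I) x : dsupp x `<=` D ->
  dlift_fun x = \sum_(i \in D) h i (dcoord x i).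
Proof.
move=> xD; apply: fsbig_widen => // i [_ /contrapT xi] /=.
by rewrite xi linear0.
Qed.

Lemma dlift_is_linear : linear dlift_fun.
Proof.
move=> a x y; pose D := dsupp x `|` dsupp y.
have finD : finite_set D by rewrite finite_setU; split; exact: finite_dsupp.
have sub_D : dsupp (a *: x + y) `<=` D.
  move=> i /= xyi; apply: contrapT => /not_orP[/contrapT xi /contrapT yi].
  by apply: xyi; rewrite dcoordP xi yi scaler0 addr0.
have [sxD syD] : dsupp x `<=` D /\ dsupp y `<=` D.
  by split=> i; [left | right].
rewrite !(@dlift_widen D) //.
rewrite !fsbig_finite // scaler_sumr -big_split; apply: eq_bigr => i _.
by rewrite dcoordP linearP.
Qed.

Definition dlift : {linear dsum V -> W} := mklin dlift_is_linear.

Lemma dlift_in i v : dlift (din i v) = h i v.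
Proof.
rewrite -[LHS]/(dlift_fun _) (@dlift_widen [set i]) ?fsbig_set1 ?dcoord_in //.
move=> j /= vj; apply: contrapT => /eqP ij; apply: vj.
by rewrite dcoord_out // eq_sym.
Qed.

End Lift.

Lemma dlift_comp (W W' : lmodType k) (h : forall i, {linear V i -> W})
    (g : {linear W -> W'}) (h' : forall i, {linear V i -> W'}) x :
  (forall i v, h' i v = g (h i v)) -> dlift h' x = g (dlift h x).
Proof.
move=> h'E; rewrite -[dlift h' x]/(dlift_fun _ _) -[dlift h x]/(dlift_fun _ _).
rewrite /dlift_fun !fsbig_finite ?linear_sum; try exact: finite_dsupp.
by apply: eq_bigr => i _; rewrite h'E.
Qed.

End DirectSumMaps.

Section DirectSumHoms.
Variables (k : fieldType) (gT : finGroupType) (G : {group gT}).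
Variables (I : choiceType) (X : I -> gmod k G).

Lemma ghom_din i : @ghom _ _ _ (X i) (gdsum X) (@din k I X i).
Proof.
move=> x Gx v; apply: dsum_ext => j.
rewrite -[RHS]/(gact (X j) x (dcoord (@din k I X i v) j)).
have [<-|ij] := eqVneq i j; first by rewrite !dcoord_in.
by rewrite !dcoord_out // linear0.
Qed.

Lemma ghom_dlift (Y : gmod k G) (h : forall i, {linear X i -> Y}) :
  (forall i, ghom (h i)) -> @ghom _ _ _ (gdsum X) Y (dlift h).
Proof.
move=> hh x Gx v.
rewrite -(@dlift_comp _ _ _ _ _ h (gact Y x) (fun i => gact Y x \o h i)) //.
rewrite -![dlift _ _]/(dlift_fun _ _) (@dlift_widen _ _ _ _ _ (dsupp v)).
  by rewrite /dlift_fun; apply: eq_fsbigr => i _; rewrite hh.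
move=> i /= xi vi; apply: xi.
by rewrite -[LHS]/(gact (X i) x (dcoord v i)) vi linear0.
Qed.

End DirectSumHoms.

(** * Relative projectivity for a direct factor *)

Section DirectProduct.
Variables (k : fieldType) (gT : finGroupType) (G H C : {group gT}).
Hypothesis defG : (H \x C)%g = G.

Let sHG : H \subset G := dprod_subl defG.

Definition projH (g : gT) : gT := divgr H C g.
Definition projC (g : gT) : [subg C] := subg C (remgr H C g).

Lemma mem_projH g : g \in G -> projH g \in H.
Proof. by rewrite -(dprodW defG); exact: mem_divgr. Qed.

Lemma val_projC g : g \in G -> sgval (projC g) = remgr H C g.
Proof. by move=> Gg; rewrite subgK // mem_remgr // (dprodW defG). Qed.

Lemma projE g : g \in G -> g = (projH g * sgval (projC g))%g.
Proof. by move=> Gg; rewrite val_projC // -divgr_eq. Qed.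

Lemma sub_C_G : C \subset G.
Proof. by case/dprod_normal2: defG => _ /normal_sub. Qed.

Lemma valC_in_G (x : [subg C]) : sgval x \in G.
Proof. exact: (fintype.subsetP sub_C_G) (subgP x). Qed.

Lemma projHM : {in G &, {morph projH : x y / (x * y)%g}}.
Proof.
have [_ _ cHC _] := dprodP defG.
by apply: divgrM cHC; exact/sdprod_compl/dprodWsd.
Qed.

Lemma projCM : {in G &, {morph projC : x y / (x * y)%g}}.
Proof.
move=> x y Gx Gy; rewrite /projC (remgrM (sdprod_compl (dprodWsd defG))) //.
  by rewrite morphM // mem_remgr // (dprodW defG).
by case/dprod_normal2: defG.
Qed.

Lemma projH_H h : h \in H -> projH h = h.
Proof. exact: divgr_id. Qed.

Lemma projC_H h : h \in H -> projC h = 1%g.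
Proof. by move=> Hh; rewrite /projC remgr1 // morph1. Qed.

Lemma remgr_val (x : [subg C]) : remgr H C (sgval x) = sgval x.
Proof. by apply: remgr_id (subgP x); case/dprodP: defG. Qed.

Lemma projH_C (x : [subg C]) : projH (sgval x) = 1%g.
Proof. by rewrite /projH /divgr remgr_val mulgV. Qed.

Lemma projC_C (x : [subg C]) : projC (sgval x) = x.
Proof. by rewrite /projC remgr_val sgvalK. Qed.

Lemma commute_HC h (x : [subg C]) : h \in H -> (h * sgval x = sgval x * h)%g.
Proof.
case/dprodP: defG => _ _ /centsP cHC _ Hh; apply/esym/cHC => //.
exact: subgP.
Qed.

Lemma valC_mulV (x : [subg C]) g : g \in G ->
  ((sgval x)^-1 * g = projH g * (sgval ((projC g)^-1 * x)%g)^-1)%g.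
Proof.
move=> Gg; rewrite -[sgval (_^-1 * x)%g]/((sgval (projC g))^-1 * sgval x)%g.
rewrite invMg invgK mulgA.
rewrite (_ : projH g * (sgval x)^-1 = (sgval x)^-1 * projH g)%g.
  by rewrite -mulgA -projE.
by rewrite -[((sgval x)^-1)%g]/(sgval (x^-1)%g) commute_HC ?mem_projH.
Qed.

Lemma valC_mul (x : [subg C]) g : g \in G ->
  (g * sgval x = sgval (projC g * x)%g * projH g)%g.
Proof.
move=> Gg; rewrite -commute_HC ?mem_projH //.
by rewrite -[sgval (_ * x)%g]/(sgval (projC g) * sgval x)%g mulgA -projE.
Qed.

Lemma mem_H_valC (x : [subg C]) g : g \in G ->
  ((sgval x)^-1 * g \in H)%g = (x == projC g).
Proof.
move=> Gg; rewrite valC_mulV // groupMl ?mem_projH // groupV.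
apply/idP/eqP => [Hx|->]; last by rewrite mulVg group1.
have [_ _ _ tiHC] := dprodP defG.
have : sgval ((projC g)^-1 * x)%g \in (H :&: C)%g by rewrite inE Hx subgP.
rewrite tiHC => /set1gP gx1; apply/esym/eqP; rewrite eq_mulVg1; apply/eqP.
exact: subg_inj.
Qed.

Definition trace (P : gmod k G) (f : P -> P) (v : P) : P :=
  \sum_(x : [subg C]) gact P (sgval x) (f (gact P (sgval x)^-1%g v)).

(** Higman's criterion for projectivity relative to H: the cosets of H in G
    are represented by C. This form is inherited by tensor products, direct
    sums and retracts, whence by all w-projective modules when w has it. *)
Definition higman (P : gmod k G) : Prop :=
  exists2 f : {linear P -> P},
    @ghom _ _ _ (gres sHG P) (gres sHG P) f & forall v, trace f v = v.

Lemma higman_retract (P X : gmod k G)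
    (a : {linear X -> P}) (b : {linear P -> X}) :
  ghom a -> ghom b -> cancel a b -> higman P -> higman X.
Proof.
move=> ha hb aK [f hf tr_f]; exists (b \o f \o a) => [h Hh v|v] /=.
  have Gh := fintype.subsetP sHG h Hh.
  by rewrite ha // (hf h Hh (a v)) hb.
rewrite -[RHS]aK -[a v]tr_f linear_sum; apply: eq_bigr => x _.
by rewrite hb ?valC_in_G // /= ha // groupV valC_in_G.
Qed.

Lemma higman_gtensor (X Y : gmod k G) : higman X -> higman (gtensor X Y).
Proof.
case=> f hf tr_f; exists (tmap f idfun) => [h Hh t|t].
  rewrite /= (tmap_comp (f'' := f \o gact X h) (g'' := gact Y h)) //.
  by apply/esym/tmap_comp => v //=; rewrite (hf h Hh v).
(* The identity only has to be checked on elementary tensors. *)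
have lin_tr : linear (trace (tmap f idfun : gtensor X Y -> gtensor X Y)).
  move=> a u v; rewrite /trace scaler_sumr -big_split; apply: eq_bigr => x _.
  by rewrite !linearP.
move: t; apply: (tensor_ext (f := mklin lin_tr) (g := idfun)) => u v.
suff: trace (tmap f idfun : gtensor X Y -> _) (tmul u v) = tmul u v by [].
rewrite -[in RHS](tr_f u) /trace tmul_suml; apply: eq_bigr => x _.
rewrite /= !tmapE /= -gactM ?groupV ?valC_in_G //.
by rewrite mulgV gact1.
Qed.

Lemma higman_gdsum (I : Type) (F : I -> gmod k G) :
  (forall i, higman (F i)) -> higman (gdsum F).
Proof.
move=> hF.
pose f i := s2val (cid2 (hF i)).
have hf i : @ghom _ _ _ (gres sHG (F i)) (gres sHG (F i)) (f i).
  exact: s2valP (cid2 (hF i)).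
have tr_f i v : trace (f i) v = v by apply: s2valP' (cid2 (hF i)) _.
exists (dsum_map f) => [h Hh u|u]; apply: dsum_ext => i.
  exact: hf i h Hh (dcoord u i).
have lin_i : linear (fun u : gdsum F => dcoord u i) by [].
rewrite -[RHS](tr_f i); exact: (linear_sum (mklin lin_i)).
Qed.

Section InducedModules.
Variables (Q : {group gT}) (sQH : Q \subset H) (Y : gmod k Q).

Let rel := @ind_rel k gT G Q Y.

(** As Q is contained in H, restricting functions on G to H respects the
    relations that define the induced module. The conjugates by C of this
    endomorphism restrict functions to the cosets of H, so that they add up to
    the identity. *)
Definition supportH (u : {ffun [subg G] -> Y}) : {ffun [subg G] -> Y} :=
  [ffun x => if sgval x \in H then u x else 0].

Lemma supportH_is_linear : linear supportH.
Proof.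
move=> a u v; apply/ffunP => x; rewrite !ffunE.
by case: ifP => //; rewrite scaler0 addr0.
Qed.

Lemma supportH_rel u : rel u -> (lpi rel \o mklin supportH_is_linear) u = 0.
Proof.
case=> x h v Qh /=.
have Hh := fintype.subsetP sQH h Qh; have Gh := fintype.subsetP sHG h Hh.
have supp_x y v' :
    supportH (gdelta y v') = if sgval y \in H then gdelta y v' else 0.
  apply/ffunP => z.
  rewrite (fun_if (fun u : {ffun [subg G] -> Y} => u z)) !ffunE.
  by have [->|_] := eqVneq z y; rewrite ?if_same.
have suppB := linearB (mklin supportH_is_linear).
rewrite [supportH _]suppB /= !supp_x.
have -> : (sgval (x * subg G h)%g \in H) = (sgval x \in H).
  by rewrite -[sgval _]/(sgval x * sgval (subg G h))%g subgK // groupMr.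
case: ifP => _; last by rewrite subrr linear0.
rewrite -[RHS](linear0 (lpi rel)); apply/lpiP; rewrite subr0.
exact/mem_span/IndRel.
Qed.

Lemma gact_gindE x u :
  gact (gind G Y) x (lpi rel u) = lpi rel (gshift (subg G x) u).
Proof. exact: lquot_liftE. Qed.

Lemma higman_gind : higman (gind G Y).
Proof.
pose f : {linear gind G Y -> gind G Y} := lquot_lift supportH_rel.
have fE u : f (lpi rel u) = lpi rel (supportH u) by exact: lquot_liftE.
exists f => [h Hh|].
  pose a := gact (gind G Y) h.
  suff fa : forall u, f (a (lpi rel u)) = a (f (lpi rel u)).
    exact: (@lquot_ext k _ (gind G Y) rel (f \o a) (a \o f) fa).
  move=> u; rewrite fE /a !gact_gindE fE; congr lpi.
  have Gh := fintype.subsetP sHG h Hh.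
  apply/ffunP => y; rewrite !ffunE; congr (if _ then _ else _).
  rewrite -[sgval (_ * y)%g]/((sgval (subg G h))^-1 * sgval y)%g subgK //.
  by rewrite groupMl // groupV.
suff tr_f : forall u, @trace (gind G Y) f (lpi rel u) = lpi rel u.
  exact: (@lquot_ext k _ (gind G Y) rel (@trace (gind G Y) f) id tr_f).
move=> u; rewrite /trace (eq_bigr (fun x : [subg C] => lpi rel
   (gshift (subg G (sgval x)) (supportH (gshift (subg G (sgval x)^-1%g) u))))).
  rewrite -linear_sum; congr lpi; apply/ffunP => y; rewrite sum_ffunE.
  have Gy := subgP y.
  have suppE x :
      (sgval ((subg G (sgval x))^-1 * y)%g \in H) = (x == projC (sgval y)).
    rewrite -[sgval (_ * y)%g]/((sgval (subg G (sgval x)))^-1 * sgval y)%g.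
    by rewrite subgK ?valC_in_G // mem_H_valC.
  rewrite (bigD1 (projC (sgval y))) //= big1 => [|x xy].
    rewrite !ffunE suppE eqxx addr0; congr (u _).
    by rewrite morphV ?valC_in_G // invgK mulKVg.
  by rewrite !ffunE suppE (negPf xy).
by move=> x _; rewrite gact_gindE fE gact_gindE.
Qed.

End InducedModules.

Lemma higman_wproj (w P : gmod k G) : higman w -> wproj w P -> higman P.
Proof.
move=> hw; elim=> {P} // [X Y _|I F _|X Y _ hY].
- exact: higman_gtensor.
- exact: higman_gdsum.
- by case/gsummand_split => a [b [ha hb aK]]; exact: higman_retract ha hb aK hY.
Qed.

(** H is normal, so that it contains Q and not merely a conjugate of Q. *)
Lemma higman_vertex (w : gmod k G) :
  (exists Q : {group gT}, is_vertex w Q /\ conj_sub G Q H) -> higman w.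
Proof.
case=> Q [[sQG [Y /gsummand_split[a [b [ha hb aK]]]] _] [x Gx sQxH]].
apply: higman_retract ha hb aK (higman_gind _ _).
have /normsP nHG : G \subset 'N(H)%g.
  by case/dprod_normal2: defG => /normal_norm.
by rewrite -(conjSg _ _ x) nHG.
Qed.

End DirectProduct.

(** * Modules coinduced from a direct factor *)

Section Coinduction.
Variables (k : fieldType) (gT : finGroupType) (G H C : {group gT}).
Hypothesis defG : (H \x C)%g = G.

Let sHG : H \subset G := dprod_subl defG.

Section CoindModule.
Variable V : gmod k H.

Definition coind_act (g : gT) (f : {ffun [subg C] -> V}) :
    {ffun [subg C] -> V} :=
  [ffun x => gact V (projH H C g) (f ((projC H C g)^-1 * x)%g)].

Lemma coind_act_is_linear g : linear (coind_act g).
Proof. by move=> a u v; apply/ffunP => x; rewrite !ffunE linearP. Qed.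

(** Since C is finite, this module is both induced and coinduced from V. *)
Definition coind : gmod k G.
Proof.
exists {ffun [subg C] -> V} (fun g => mklin (coind_act_is_linear g))
  => [f|g g' Gg Gg' f].
  apply/ffunP => x; rewrite ffunE projH_H // projC_H //.
  by rewrite invg1 mul1g gact1.
apply/ffunP => x; rewrite !ffunE (projHM defG) // (projCM defG) //.
by rewrite gactM ?(mem_projH defG) // invMg mulgA.
Defined.

Lemma coind_ev_is_linear x : linear (fun f : coind => (f : {ffun _ -> _}) x).
Proof. by move=> a f g; rewrite !ffunE. Qed.

Definition coind_ev x : {linear coind -> V} := mklin (coind_ev_is_linear x).

Lemma coind_ext (f g : coind) :
  (forall x, coind_ev x f = coind_ev x g) -> f = g.
Proof. by move=> fg; apply/ffunP. Qed.

Lemma coind_ev_act x g (f : coind) :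
  coind_ev x (gact coind g f) =
  gact V (projH H C g) (coind_ev ((projC H C g)^-1 * x)%g f).
Proof. exact: ffunE. Qed.

Lemma coind_ev_actC x (c : [subg C]) (f : coind) :
  coind_ev x (gact coind (sgval c) f) = coind_ev (c^-1 * x)%g f.
Proof. by rewrite coind_ev_act (projH_C defG) (projC_C defG) gact1. Qed.

Lemma coind_ev_actH x h (f : coind) : h \in H ->
  coind_ev x (gact coind h f) = gact V h (coind_ev x f).
Proof.
by move=> Hh; rewrite coind_ev_act projH_H // projC_H // invg1 mul1g.
Qed.

Section Product.
Variables (S : lmodType k) (F : [subg C] -> {linear S -> V}).

Lemma coind_prod_is_linear :
  linear (fun s => [ffun x => F x s] : coind).
Proof. by move=> a u v; apply/ffunP => x; rewrite !ffunE linearP. Qed.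

Definition coind_prod : {linear S -> coind} := mklin coind_prod_is_linear.

Lemma coind_prodE x s : coind_ev x (coind_prod s) = F x s.
Proof. exact: ffunE. Qed.

End Product.

(** The adjunction between restriction and coinduction, whose counit is
    evaluation at 1. *)
Definition coind_adj (S : gmod k G) (f : {linear S -> V}) :
    {linear S -> coind} :=
  coind_prod (fun x => f \o gact S (sgval x)^-1%g).

Lemma ghom_coind_adj (S : gmod k G) (f : {linear S -> V}) :
  @ghom _ _ _ (gres sHG S) V f -> ghom (coind_adj f).
Proof.
move=> hf g Gg s; apply: coind_ext => x.
rewrite coind_ev_act !coind_prodE /= -hf ?(mem_projH defG) //=; congr (f _).
have Gx (y : [subg C]) : (sgval y)^-1%g \in G.
  by rewrite groupV (valC_in_G defG).
have Gh := fintype.subsetP sHG _ (mem_projH defG Gg).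
by rewrite -gactM // (valC_mulV defG) // gactM.
Qed.

Lemma coind_adjK (S : gmod k G) (f : {linear S -> coind}) s : ghom f ->
  f s = coind_adj (coind_ev 1%g \o f) s.
Proof.
move=> hf; apply: coind_ext => x; rewrite coind_prodE.
rewrite -[RHS]/(coind_ev 1%g (f (gact S (sgval x)^-1%g s))) hf.
  rewrite -[((sgval x)^-1)%g]/(sgval (x^-1)%g) coind_ev_actC.
  by rewrite invgK mulg1.
by rewrite groupV (valC_in_G defG).
Qed.

End CoindModule.

Arguments coind_ev {V} x.

Definition coind_map (V W : gmod k H) (f : {linear V -> W}) :
  {linear coind V -> coind W} := coind_prod (fun x => f \o coind_ev x).

Lemma coind_mapE (V W : gmod k H) (f : {linear V -> W}) x u :
  coind_ev x (coind_map f u) = f (coind_ev x u).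
Proof. exact: coind_prodE. Qed.

Lemma ghom_coind_map (V W : gmod k H) (f : {linear V -> W}) :
  ghom f -> ghom (coind_map f).
Proof.
move=> hf g Gg u; apply: coind_ext => x.
by rewrite coind_mapE !coind_ev_act coind_mapE hf // (mem_projH defG).
Qed.

(** C acts on functions by translation on the left, so that translation by c
    on the right is an endomorphism. *)
Definition coind_shift (V : gmod k H) (c : [subg C]) :
    {linear coind V -> coind V} :=
  coind_prod (fun x => (coind_ev (x * c)%g \- coind_ev x)).

Arguments coind_shift {V} c.

Lemma coind_shiftE (V : gmod k H) c x (u : coind V) :
  coind_ev x (coind_shift c u) = coind_ev (x * c)%g u - coind_ev x u.
Proof. exact: coind_prodE. Qed.

Lemma ghom_coind_shift (V : gmod k H) c : ghom (@coind_shift V c).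
Proof.
move=> g Gg u; apply: coind_ext => x.
by rewrite coind_shiftE !coind_ev_act coind_shiftE linearB mulgA.
Qed.

(** Since C acts on w, w (x) coind Z and coind (w (x) Z) are isomorphic but
    not equal: the value at x has to be twisted by the action of x on w. *)
Section Projection.
Variables (w : gmod k G) (Z : gmod k H).

Let wZ := gtensor (gres sHG w) Z.

Definition coind_delta (x : [subg C]) : {linear Z -> coind Z} :=
  coind_prod (fun y => if y == x then idfun : {linear Z -> Z} else \0).

Lemma coind_deltaE x y z :
  coind_ev y (coind_delta x z) = if y == x then z else 0.
Proof. by rewrite coind_prodE; case: ifP. Qed.

Lemma coind_delta_act g x z : g \in G ->
  gact (coind Z) g (coind_delta x z) =
  coind_delta (projC H C g * x)%g (gact Z (projH H C g) z).
Proof.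
move=> Gg; apply: coind_ext => y; rewrite coind_ev_act !coind_deltaE.
rewrite (canF_eq (mulKg _)) invgK //.
by case: ifP; rewrite ?linear0.
Qed.

Definition twist_fun (u : coind wZ) : gtensor w (coind Z) :=
  \sum_(x : [subg C]) tmap (gact w (sgval x)) (coind_delta x) (coind_ev x u).

Lemma twist_is_linear : linear twist_fun.
Proof.
move=> a u v; rewrite /twist_fun scaler_sumr -big_split; apply: eq_bigr => x _.
by rewrite !linearP.
Qed.

Definition twist : {linear coind wZ -> gtensor w (coind Z)} :=
  mklin twist_is_linear.

Definition untwist : {linear gtensor w (coind Z) -> coind wZ} :=
  coind_prod (V := wZ) (fun x =>
    tmap (gact w (sgval x)^-1%g) (coind_ev x : {linear coind Z -> Z})).

Lemma ghom_twist : ghom twist.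
Proof.
move=> g Gg u; rewrite /= /twist_fun linear_sum.
rewrite [RHS](reindex_inj (mulgI (projC H C g)^-1%g)); apply: eq_bigr => x _.
rewrite coind_ev_act; set t := coind_ev _ u.
have Hg := mem_projH defG Gg; have Gh := fintype.subsetP sHG _ Hg.
have Gx y := @valC_in_G _ _ _ _ defG y.
set y := (_ * x)%g; have xE : (projC H C g * y)%g = x by rewrite mulKVg.
pose f1 := gact w (g * sgval y)%g.
pose f2 := coind_delta x \o gact Z (projH H C g).
transitivity (tmap f1 f2 t).
  apply: tmap_comp => v //.
  by rewrite /f1 (valC_mul defG) // xE [RHS](@gactM _ _ _ w).
apply/esym/tmap_comp => v; first by rewrite /f1 gactM.
by rewrite coind_delta_act // xE.
Qed.

Lemma ghom_untwist : ghom untwist.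
Proof.
move=> g Gg u; apply: coind_ext => x; rewrite coind_ev_act !coind_prodE /=.
have Hg := mem_projH defG Gg; have Gh := fintype.subsetP sHG _ Hg.
have Gx (y : [subg C]) : (sgval y)^-1%g \in G.
  by rewrite groupV (valC_in_G defG).
pose f1 := gact w ((sgval x)^-1 * g)%g.
pose f2 := coind_ev x \o gact (coind Z) g.
transitivity (tmap f1 f2 u).
  by apply: tmap_comp => v //; rewrite /f1 gactM.
apply/esym/tmap_comp => v; last first.
  by rewrite -[RHS]/(coind_ev x (gact (coind Z) g v)) coind_ev_act.
by rewrite /f1 (valC_mulV defG) // [RHS](@gactM _ _ _ w).
Qed.

Lemma twistK : cancel twist untwist.
Proof.
move=> u; apply: coind_ext => y; rewrite coind_prodE /= /twist_fun linear_sum.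
rewrite (bigD1 y) //= big1 ?addr0 => [|x xy].
  rewrite (tmap_comp (f'' := idfun) (g'' := idfun)) ?tmap_id // => v.
    by rewrite -gactM ?groupV ?(valC_in_G defG) // mulVg gact1.
  by rewrite coind_deltaE eqxx.
rewrite (tmap_comp (g'' := \0)
  (f'' := gact w (sgval y)^-1%g \o gact w (sgval x))) //.
  by rewrite tmap_0r.
by move=> v; rewrite coind_deltaE eq_sym (negPf xy).
Qed.

End Projection.

Lemma wproj_coind (w : gmod k G) (Y Z : gmod k H) :
  gsummand Y (gtensor (gres sHG w) Z) -> wproj w (coind Y).
Proof.
case/gsummand_split => a [b [ha hb aK]].
apply: (WprojSummand (WprojTensor (coind Z) (WprojBase w))).
apply: (@gsummand_retract _ _ _ _ _ (@twist w Z \o coind_map a)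
                                    (coind_map b \o @untwist w Z)).
- exact: ghom_comp (ghom_coind_map ha) (@ghom_twist w Z).
- exact: ghom_comp (@ghom_untwist w Z) (ghom_coind_map hb).
- move=> u; transitivity (coind_map b (coind_map a u)).
    exact: congr1 (twistK (coind_map a u)).
  by apply: coind_ext => x; rewrite !coind_mapE aK.
Qed.

End Coinduction.

Arguments coind_ev {k gT G H C} defG {V} x.
Arguments coind_shift {k gT G H C} defG {V} c.

(** * Binary sums *)

Section BinarySums.
Variables (k : fieldType) (gT : finGroupType) (G : {group gT}).
Variables X Y : gmod k G.

Lemma gin1_is_linear : linear (fun x : X => (x, 0) : gsum2 X Y).
Proof. by move=> a u v; congr (_, _); rewrite /= scaler0 addr0. Qed.

Lemma gin2_is_linear : linear (fun y : Y => (0, y) : gsum2 X Y).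
Proof. by move=> a u v; congr (_, _); rewrite /= scaler0 addr0. Qed.

Lemma gpr1_is_linear : linear (fun u : gsum2 X Y => u.1).
Proof. by []. Qed.

Lemma gpr2_is_linear : linear (fun u : gsum2 X Y => u.2).
Proof. by []. Qed.

Definition gin1 : {linear X -> gsum2 X Y} := mklin gin1_is_linear.
Definition gin2 : {linear Y -> gsum2 X Y} := mklin gin2_is_linear.
Definition gpr1 : {linear gsum2 X Y -> X} := mklin gpr1_is_linear.
Definition gpr2 : {linear gsum2 X Y -> Y} := mklin gpr2_is_linear.

Lemma ghom_gin1 : ghom gin1.
Proof. by move=> g Gg x; congr (_, _); rewrite /= linear0. Qed.

Lemma ghom_gin2 : ghom gin2.
Proof. by move=> g Gg x; congr (_, _); rewrite /= linear0. Qed.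

Lemma ghom_gpr1 : ghom gpr1. Proof. by []. Qed.
Lemma ghom_gpr2 : ghom gpr2. Proof. by []. Qed.

Lemma gpr_ext (u v : gsum2 X Y) : gpr1 u = gpr1 v -> gpr2 u = gpr2 v -> u = v.
Proof. by case: u v => [x y] [x' y'] /= -> ->. Qed.

Section Pairing.
Variables (S : gmod k G) (f : {linear S -> X}) (g : {linear S -> Y}).

Definition gpair : {linear S -> gsum2 X Y} := (gin1 \o f) \+ (gin2 \o g).

Lemma gpr1_pair s : gpr1 (gpair s) = f s.
Proof. exact: addr0. Qed.

Lemma gpr2_pair s : gpr2 (gpair s) = g s.
Proof. exact: add0r. Qed.

Lemma ghom_pair : ghom f -> ghom g -> ghom gpair.
Proof.
move=> hf hg x Gx s; apply: gpr_ext.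
  by rewrite gpr1_pair hf // -[RHS]/(gact X x (gpr1 (gpair s))) gpr1_pair.
by rewrite gpr2_pair hg // -[RHS]/(gact Y x (gpr2 (gpair s))) gpr2_pair.
Qed.

End Pairing.

Lemma ghom_add (f g : {linear X -> Y}) : ghom f -> ghom g -> ghom (f \+ g).
Proof. by move=> hf hg x Gx v; rewrite /= hf // hg // linearD. Qed.

Lemma ghom_sub (f g : {linear X -> Y}) : ghom f -> ghom g -> ghom (f \- g).
Proof. by move=> hf hg x Gx v; rewrite /= hf // hg // linearB. Qed.

End BinarySums.

Lemma gsummand_tensor_gsum2 (k : fieldType) (gT : finGroupType)
    (G : {group gT}) (W X Y : gmod k G) :
  gsummand (gsum2 (gtensor W X) (gtensor W Y)) (gtensor W (gsum2 X Y)).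
Proof.
pose t1 : {linear gtensor W X -> gtensor W (gsum2 X Y)} :=
  tmap idfun (gin1 X Y).
pose t2 : {linear gtensor W Y -> gtensor W (gsum2 X Y)} :=
  tmap idfun (gin2 X Y).
pose p1 : {linear gtensor W (gsum2 X Y) -> gtensor W X} :=
  tmap idfun (gpr1 X Y).
pose p2 : {linear gtensor W (gsum2 X Y) -> gtensor W Y} :=
  tmap idfun (gpr2 X Y).
have hid : @ghom _ _ _ W W idfun by [].
have ht1 : ghom t1 := ghom_tmap hid (@ghom_gin1 _ _ _ X Y).
have ht2 : ghom t2 := ghom_tmap hid (@ghom_gin2 _ _ _ X Y).
have hp1 : ghom p1 := ghom_tmap hid (@ghom_gpr1 _ _ _ X Y).
have hp2 : ghom p2 := ghom_tmap hid (@ghom_gpr2 _ _ _ X Y).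
apply: (@gsummand_retract _ _ _ _ _
  ((t1 \o gpr1 _ _) \+ (t2 \o gpr2 _ _)) (gpair p1 p2)).
- apply: ghom_add; first exact: ghom_comp (@ghom_gpr1 _ _ _ _ _) ht1.
  exact: ghom_comp (@ghom_gpr2 _ _ _ _ _) ht2.
- exact: ghom_pair.
have p1t1 t : p1 (t1 t) = t.
  by rewrite -[RHS](@tmap_id _ _ _ idfun idfun t) //; apply: tmap_comp.
have p2t2 t : p2 (t2 t) = t.
  by rewrite -[RHS](@tmap_id _ _ _ idfun idfun t) //; apply: tmap_comp.
have p1t2 t : p1 (t2 t) = 0.
  by rewrite -(@tmap_0r _ _ _ _ _ idfun \0 t) //; apply: tmap_comp.
have p2t1 t : p2 (t1 t) = 0.
  by rewrite -(@tmap_0r _ _ _ _ _ idfun \0 t) //; apply: tmap_comp.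
case=> u v; apply: gpr_ext; rewrite ?(gpr1_pair, gpr2_pair) linearD /=.
  by rewrite [X in X + _]p1t1 [X in _ + X]p1t2 addr0.
by rewrite [X in X + _]p2t1 [X in _ + X]p2t2 add0r.
Qed.

(** * An extension of coinduced modules *)

Section Extension.
Variables (k : fieldType) (gT : finGroupType) (G H C : {group gT}).
Hypothesis defG : (H \x C)%g = G.

Let sHG : H \subset G := dprod_subl defG.
Local Notation coind := (coind defG).

Variables (V U : gmod k H) (p : {linear V -> U}).
Hypothesis hp : ghom p.
Variable c : [subg C].

Definition ext_diff : {linear gsum2 (coind V) (coind U) -> coind U} :=
  (coind_map defG p \o gpr1 _ _) \- (coind_shift defG c \o gpr2 _ _).

Lemma ghom_ext_diff : ghom ext_diff.
Proof.
apply: ghom_sub.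
  exact: ghom_comp (@ghom_gpr1 _ _ _ _ _) (ghom_coind_map hp).
exact: ghom_comp (@ghom_gpr2 _ _ _ _ _) (@ghom_coind_shift _ _ _ _ _ _ _ _).
Qed.

(** The pullback of coind p along coind_shift c. If p is onto with kernel K,
    this is an extension of coind U by coind K: the pullback along c - 1 of
    the extension coinduced from 0 -> K -> V -> U -> 0. *)
Definition ext : gmod k G := gker ghom_ext_diff.

Definition ext1 : {linear ext -> coind V} := gpr1 _ _ \o ker_incl ext_diff.
Definition ext2 : {linear ext -> coind U} := gpr2 _ _ \o ker_incl ext_diff.

Lemma ghom_ext1 : ghom ext1.
Proof.
exact: ghom_comp (@ghom_ker_incl _ _ _ _ _ _ _) (@ghom_gpr1 _ _ _ _ _).
Qed.

Lemma ghom_ext2 : ghom ext2.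
Proof.
exact: ghom_comp (@ghom_ker_incl _ _ _ _ _ _ _) (@ghom_gpr2 _ _ _ _ _).
Qed.

Lemma ext_relation z : coind_map defG p (ext1 z) = coind_shift defG c (ext2 z).
Proof. exact/subr0_eq/(ker_inclK z). Qed.

Lemma ext_ext z z' : ext1 z = ext1 z' -> ext2 z = ext2 z' -> z = z'.
Proof. by move=> e1 e2; apply/ker_incl_inj/gpr_ext. Qed.

Lemma ext_pair (S : gmod k G) (f : {linear S -> coind V})
    (g : {linear S -> coind U}) :
    ghom f -> ghom g ->
    (forall s, coind_map defG p (f s) = coind_shift defG c (g s)) ->
  exists2 h : {linear S -> ext}, ghom h &
    forall s, ext1 (h s) = f s /\ ext2 (h s) = g s.
Proof.
move=> hf hg fg.
have [||||h hh hE] := @lift_ghom _ _ _ S ext _ (ker_incl ext_diff) (gpair f g).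
- exact: ghom_ker_incl.
- exact: ghom_pair.
- exact: ker_incl_inj.
- move=> s; apply: ker_incl_surj; apply/eqP; rewrite subr_eq0; apply/eqP.
  rewrite -[RHS]/(coind_shift defG c _) -[LHS]/(coind_map defG p _).
  by rewrite gpr1_pair gpr2_pair.
exists h => // s; split.
  by rewrite -[LHS]/(gpr1 _ _ _) hE gpr1_pair.
by rewrite -[LHS]/(gpr2 _ _ _) hE gpr2_pair.
Qed.

End Extension.

Section ExtensionProperties.
Variables (k : fieldType) (gT : finGroupType) (G H C : {group gT}).
Hypothesis defG : (H \x C)%g = G.

Let sHG : H \subset G := dprod_subl defG.
Local Notation coind := (coind defG).
Local Notation cev := (coind_ev defG).

Variables (V U : gmod k H) (p : {linear V -> U}).
Hypothesis hp : ghom p.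
Variable c : [subg C].

Local Notation E := (ext defG hp c).

(** Let ft : S -> coind V be adjoint to a lift along p of the adjoint of the
    second component of f. The pair (c - 1, p) maps coind V to ext and ft to
    a homomorphism with the same second component as f; the difference is
    killed by p in its first component, and lies in coind K. *)
Lemma ext_factor (K : gmod k H) (i : {linear K -> V}) (S : gmod k G)
    (f : {linear S -> E}) :
    ghom i -> injective i -> (forall u, p (i u) = 0) ->
    (forall v, p v = 0 -> exists u, i u = v) ->
    (forall g : {linear S -> U}, @ghom _ _ _ (gres sHG S) U g ->
       exists2 h : {linear S -> V}, @ghom _ _ _ (gres sHG S) V h &
         forall s, p (h s) = g s) ->
    ghom f ->
  exists (a : {linear S -> coind (gsum2 K V)})
         (b : {linear coind (gsum2 K V) -> E}),
    [/\ ghom a, ghom b & forall s, f s = b (a s)].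
Proof.
move=> hi inj_i pi0 exact_i lift_p hf.
pose f1 : {linear S -> coind V} := ext1 defG hp c \o f.
pose f2 : {linear S -> coind U} := ext2 defG hp c \o f.
have hf1 : ghom f1 := ghom_comp hf (@ghom_ext1 _ _ _ _ _ defG _ _ _ hp c).
have hf2 : ghom f2 := ghom_comp hf (@ghom_ext2 _ _ _ _ _ defG _ _ _ hp c).
have f12 s : coind_map defG p (f1 s) = coind_shift defG c (f2 s).
  exact: ext_relation.
have [h hh ph] : exists2 h : {linear S -> V}, @ghom _ _ _ (gres sHG S) V h &
    forall s, p (h s) = cev 1%g (f2 s).
  apply: (lift_p (cev 1%g \o f2)) => x Hx s.
  rewrite -[LHS]/(cev 1%g (f2 (gact S x s))) hf2; last first.
    exact: (fintype.subsetP sHG).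
  exact: coind_ev_actH.
pose ft : {linear S -> coind V} := coind_adj defG h.
have hft : ghom ft := ghom_coind_adj hh.
have pft s : coind_map defG p (ft s) = f2 s.
  rewrite (coind_adjK s hf2); apply: coind_ext => x.
  by rewrite coind_mapE !coind_prodE; exact: ph.
have map_shift s : coind_map defG p (coind_shift defG c (ft s)) =
    coind_shift defG c (coind_map defG p (ft s)).
  apply: coind_ext => x.
  by rewrite coind_mapE !coind_shiftE linearB !coind_mapE.
pose f0 : {linear S -> coind V} := f1 \- (coind_shift defG c \o ft).
have hf0 : ghom f0.
  by apply: ghom_sub hf1 _; apply: ghom_comp hft _; exact: ghom_coind_shift.
have pf0 s : coind_map defG p (f0 s) = 0.
  by rewrite linearB f12 map_shift pft subrr.
have [||||a1 ha1 ia1] := @lift_ghom _ _ _ S (coind K) _ (coind_map defG i) f0.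
- exact: ghom_coind_map.
- exact: hf0.
- move=> u v uv; apply: coind_ext => x; apply: inj_i.
  by rewrite -!(coind_mapE (defG := defG)) uv.
- move=> s; have /choice[u iu] : forall x, exists u, i u = cev x (f0 s).
    move=> x; apply: exact_i.
    by rewrite -(coind_mapE (defG := defG)) pf0 linear0.
  exists [ffun x => u x]; apply: coind_ext => x.
  by rewrite coind_mapE -iu; congr (i _); exact: ffunE.
pose b1 : {linear coind (gsum2 K V) -> coind V} :=
  coind_map defG (i \o gpr1 K V) \+
    (coind_shift defG c \o coind_map defG (gpr2 K V)).
pose b2 : {linear coind (gsum2 K V) -> coind U} :=
  coind_map defG (p \o gpr2 K V).
have b1E t x : cev x (b1 t) = i (gpr1 K V (cev x t)) +
    (gpr2 K V (cev (x * c)%g t) - gpr2 K V (cev x t)).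
  rewrite -[b1 t]/(coind_map defG (i \o gpr1 K V) t +
    coind_shift defG c (coind_map defG (gpr2 K V) t)) linearD.
  by rewrite coind_shiftE !coind_mapE.
have b2E t x : cev x (b2 t) = p (gpr2 K V (cev x t)) by rewrite coind_mapE.
have [|||b hb bE] := @ext_pair _ _ _ _ _ defG _ _ _ hp c _ b1 b2.
- apply: ghom_add.
    exact/ghom_coind_map/(ghom_comp (@ghom_gpr1 _ _ _ K V) hi).
  apply: ghom_comp (@ghom_coind_shift _ _ _ _ _ _ _ _).
  exact/ghom_coind_map/(@ghom_gpr2 _ _ _ K V).
- exact/ghom_coind_map/(ghom_comp (@ghom_gpr2 _ _ _ K V) hp).
- move=> t; apply: coind_ext => x.
  by rewrite coind_mapE b1E linearD pi0 add0r linearB coind_shiftE !b2E.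
pose a : {linear S -> coind (gsum2 K V)} :=
  (coind_map defG (gin1 K V) \o a1) \+ (coind_map defG (gin2 K V) \o ft).
have aE s x : cev x (a s) = gin1 K V (cev x (a1 s)) + gin2 K V (cev x (ft s)).
  by rewrite linearD !coind_mapE.
have a1E s x : gpr1 K V (cev x (a s)) = cev x (a1 s).
  by rewrite aE; exact: addr0.
have a2E s x : gpr2 K V (cev x (a s)) = cev x (ft s).
  by rewrite aE; exact: add0r.
exists a, b; split=> // [|s].
  by apply: ghom_add; [apply: ghom_comp ha1 _ | apply: ghom_comp hft _];
    apply: ghom_coind_map; [exact: ghom_gin1 | exact: ghom_gin2].
have [e1 e2] := bE (a s); apply: ext_ext; rewrite ?e1 ?e2.
  apply: coind_ext => x; rewrite b1E !a2E a1E -(coind_mapE (defG := defG)) ia1.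
  rewrite -coind_shiftE -linearD; congr (cev x _).
  by rewrite -[f0 s]/(f1 s - coind_shift defG c (ft s)) subrK.
apply: coind_ext => x.
by rewrite b2E a2E -[LHS]/(cev x (f2 s)) -pft coind_mapE.
Qed.

(** The constant functions with values u give a homomorphism y : U -> ext over
    H whose values (0, const u) are fixed by C. Hence y u is the trace of
    F (y u), where F has trace 1. Let m x and b x be the components of F \o y
    at x. Then the m (x^-1) add up to the identity of U, while
    p \o b x = m (x * c) - m x shows that m (c ^+ n) differs from m 1 by a map
    which factors through p. Summing over C, the #|C| copies of m 1 cancel and
    the identity of U factors through p. *)
Lemma ext_split : (forall x : [subg C], exists j, x = (c ^+ j)%g) ->
    #|C|%:R = 0 :> k -> higman defG E ->
  exists2 s : {linear U -> V}, ghom s & cancel s p.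
Proof.
move=> /choice[j jE] C0 [F hF tr_F].
pose const : {linear U -> coind U} := coind_prod defG (fun _ => idfun).
have constE u x : cev x (const u) = u by exact: coind_prodE.
have rel0 u : ext_diff defG p c (0, const u) = 0.
  apply: coind_ext => x.
  rewrite -[ext_diff defG p c _]/(coind_map defG p 0 -
    coind_shift defG c (const u)).
  by rewrite !linear0 sub0r linearN coind_shiftE !constE subrr oppr0.
have lin_0const : linear (fun u => (0, const u) : gsum2 (coind V) (coind U)).
  by move=> a u v; rewrite linearP; congr (_, _); rewrite /= scaler0 addr0.
have [||y yE] := @lift_linear _ _ _ _ (ker_incl (ext_diff defG p c))
                                      (mklin lin_0const).
- exact: ker_incl_inj.
- by move=> u; apply: ker_incl_surj; exact: rel0.
have y1 u : ext1 defG hp c (y u) = 0 by rewrite -[LHS]/(gpr1 _ _ _) yE.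
have y2 u : ext2 defG hp c (y u) = const u by rewrite -[LHS]/(gpr2 _ _ _) yE.
have yH h u : h \in H -> y (gact U h u) = gact E h (y u).
  move=> Hh; have Gh := fintype.subsetP sHG h Hh.
  apply: (@ext_ext _ _ _ _ _ defG _ _ _ hp c).
    by rewrite ghom_ext1 // !y1 linear0.
  rewrite ghom_ext2 // !y2; apply: coind_ext => x.
  by rewrite coind_ev_actH // !constE.
have yC (x : [subg C]) u : gact E (sgval x) (y u) = y u.
  apply: (@ext_ext _ _ _ _ _ defG _ _ _ hp c).
    by rewrite ghom_ext1 ?(valC_in_G defG) // !y1 linear0.
  rewrite ghom_ext2 ?(valC_in_G defG) // y2; apply: coind_ext => z.
  by rewrite coind_ev_actC !constE.
pose m x u := cev x (ext2 defG hp c (F (y u))).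
pose b x u := cev x (ext1 defG hp c (F (y u))).
have b_lin x : linear (b x) by move=> a u v; rewrite /b !linearP.
have b_H x h u : h \in H -> b x (gact U h u) = gact V h (b x u).
  move=> Hh; have Gh := fintype.subsetP sHG h Hh.
  by rewrite /b yH // (hF h Hh) ghom_ext1 // coind_ev_actH.
have pb x u : p (b x u) = m (x * c)%g u - m x u.
  by rewrite /b -coind_mapE ext_relation coind_shiftE.
have m_exp u n : m (c ^+ n)%g u = m 1%g u + p (\sum_(i < n) b (c ^+ i)%g u).
  elim: n => [|n IHn]; first by rewrite big_ord0 linear0 addr0.
  by rewrite big_ord_recr linearD addrA -IHn pb -expgSr addrC subrK.
have sum_m u : \sum_(x : [subg C]) m (x^-1)%g u = u.
  rewrite -[RHS](constE u 1%g) -y2 -[y u]tr_F /trace !linear_sum.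
  apply: eq_bigr => x _.
  rewrite -[((sgval x)^-1)%g]/(sgval (x^-1)%g) yC.
  by rewrite ghom_ext2 ?(valC_in_G defG) // coind_ev_actC mulg1.
pose s u := \sum_(x : [subg C]) \sum_(i < j (x^-1)%g) b (c ^+ i)%g u.
have s_lin : linear s.
  move=> a u v; rewrite /s scaler_sumr -big_split; apply: eq_bigr => x _.
  rewrite scaler_sumr -big_split; apply: eq_bigr => i _; exact: b_lin.
exists (mklin s_lin) => [h Hh u|u]; rewrite !mklinE /s.
  rewrite linear_sum; apply: eq_bigr => x _; rewrite linear_sum.
  by apply: eq_bigr => i _; rewrite b_H.
rewrite linear_sum -[RHS]sum_m.
have cardC : \sum_(x : [subg C]) m 1%g u = 0.
  rewrite sumr_const -scaler_nat (_ : #|_| = #|C|) ?C0 ?scale0r //.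
  by rewrite card_sub; apply: eq_card => x; rewrite inE.
rewrite [RHS](eq_bigr (fun x : [subg C] => m 1%g u +
    p (\sum_(i < j (x^-1)%g) b (c ^+ i)%g u))); last first.
  by move=> x _; rewrite {1}(jE (x^-1)%g) m_exp.
by rewrite big_split /= cardC add0r.
Qed.

End ExtensionProperties.

(** * Finite dimensional submodules and purity *)

Lemma findim_row (k : fieldType) n : findim 'rV[k]_n.
Proof.
exists n; constructor; exists id => //.
by exists id.
Qed.

(** A basis of the span of r is extracted one vector at a time, and encoded as
    an injective map from a space of row vectors; the last clause says that
    the image is no larger than the span. *)
Lemma span_row_space (k : fieldType) (V : lmodType k) (r : seq V) :
  exists n (f : {linear 'rV[k]_n -> V}),
    [/\ injective f, {in r, forall v, exists u, f u = v} &
        forall A : set V, subspace A -> {in r, forall v, A v} ->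
          forall u, A (f u)].
Proof.
elim: r => [|v r [n [f [inj_f f_r f_A]]]].
  have lin0 : linear (fun _ : 'rV[k]_0 => 0 : V).
    by move=> a u u'; rewrite scaler0 addr0.
  exists 0%N, (mklin lin0); split=> // [u u' _|A [A0 _] _ u //].
  by rewrite (thinmx0 u) (thinmx0 u').
have [[u0 fu0]|nfv] := pselect (exists u, f u = v).
  exists n, f; split=> // [v'|A sA Ar]; last first.
    by apply: f_A => // v' rv'; apply: Ar; rewrite inE rv' orbT.
  by rewrite inE => /predU1P[->|/f_r //]; exists u0.
have lin_g : linear
    (fun u : 'rV[k]_(n + 1) => f (lsubmx u) + rsubmx u 0 0 *: v).
  move=> a u u'; rewrite !linearP !mxE scalerDl scalerDr -scalerA addrACA.
  by [].
exists (n + 1)%N, (mklin lin_g); split.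
- suff inj0 (u : 'rV[k]_(n + 1)) :
      f (lsubmx u) + rsubmx u 0 0 *: v = 0 -> u = 0.
    move=> u u' /eqP; rewrite -subr_eq0 -linearB => /eqP/inj0/eqP.
    by rewrite subr_eq0 => /eqP.
  move=> gu0; have ru0 : rsubmx u 0 0 = 0.
    apply: contrapT => /eqP ru; apply: nfv.
    exists (- (rsubmx u 0 0)^-1 *: lsubmx u); rewrite linearZ /=.
    have -> : f (lsubmx u) = - (rsubmx u 0 0 *: v).
      by apply/eqP; rewrite -addr_eq0 gu0.
    by rewrite scaleNr scalerN opprK scalerA mulVf // scale1r.
  rewrite -[u]hsubmxK; move: gu0; rewrite ru0 scale0r addr0.
  move=> /eqP; rewrite -(linear0 f) => /eqP/inj_f->.
  suff -> : rsubmx u = 0 by rewrite row_mx0.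
  by apply/rowP => i; rewrite !ord1 ru0 mxE.
- move=> v'; rewrite inE => /predU1P[->|/f_r[u fu]].
    exists (row_mx 0 (const_mx 1)).
    by rewrite mklinE row_mxKl row_mxKr linear0 add0r mxE scale1r.
  exists (row_mx u 0).
  by rewrite mklinE row_mxKl row_mxKr mxE scale0r addr0.
move=> A sA Ar u; rewrite mklinE addrC; apply: (proj2 sA).
  by apply: Ar; rewrite inE eqxx.
by apply: f_A => // v' rv'; apply: Ar; rewrite inE rv' orbT.
Qed.

Section FiniteDimensionalSubmodules.
Variables (k : fieldType) (gT : finGroupType) (G : {group gT}).
Implicit Types M N S W : gmod k G.

Definition fd_submodule M (r : seq M) N (h : {linear N -> M}) :=
  [/\ findim N, ghom h, injective h & {in r, forall v, exists u, h u = v}].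

(** G being finite, the translates of r under G are finitely many, and their
    span is stable under G. *)
Lemma exists_fd_submodule M (r : seq M) : exists N h, @fd_submodule M r N h.
Proof.
pose Gr := [seq gact M x v | x <- enum G, v <- r].
have [n [f [inj_f f_r f_A]]] := span_row_space Gr.
have mem_Gr x v : x \in G -> v \in r -> gact M x v \in Gr.
  by move=> Gx rv; apply/allpairsP; exists (x, v); rewrite mem_enum.
have f_stable x u : x \in G -> exists u', f u' = gact M x (f u).
  move: x.
  pose A := [set v | forall x, x \in G -> exists u', f u' = gact M x v].
  suff : A (f u) by [].
  apply: f_A => [|v /allpairsP[[y v'] /= [Gy rv' ->]] x Gx]; last first.
    rewrite mem_enum in Gy; rewrite -gactM //; apply: f_r.
    by apply: mem_Gr; rewrite ?groupM.
  split=> [x Gx|a v v' Av Av' x Gx]; first by exists 0; rewrite !linear0.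
  have [[w wE] [w' wE']] := (Av x Gx, Av' x Gx).
  by exists (a *: w + w'); rewrite !linearP wE wE'.
have /choice[act actE] : forall x, exists a : {linear 'rV[k]_n -> 'rV[k]_n},
    forall u, f (a u) = gact M (if x \in G then x else 1%g) (f u).
  move=> x; apply: (@lift_linear _ _ _ _ f (gact M _ \o f)) => // u.
  by apply: f_stable; case: ifP.
have act1 u : act 1%g u = u by apply: inj_f; rewrite actE if_same gact1.
have actM x y : x \in G -> y \in G ->
    forall u, act (x * y)%g u = act x (act y u).
  by move=> Gx Gy u; apply: inj_f; rewrite !actE groupM // Gx Gy gactM.
exists (GMod act1 actM), f; split=> //; first exact: findim_row.
- by move=> x Gx u; rewrite [LHS]actE Gx.
- by move=> v rv; apply: f_r; rewrite -[v](gact1 (g := M)) mem_Gr.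
Qed.

(** The images of a basis of S have finitely many coordinates in M, relative
    to a basis of W; any N that contains these coordinates will do. *)
Lemma tensor_factor_fd W M S (f : {linear S -> gtensor W M}) :
    findim W -> findim S -> ghom f ->
  exists r : seq M, forall N (h : {linear N -> M}), fd_submodule r h ->
    exists2 g : {linear S -> gtensor W N}, ghom g &
      forall s, tmap idfun h (g s) = f s.
Proof.
move=> fdW /findim_dual_bases[d [b [b' bb']]] hf.
have [n [e [e' ee']]] := findim_dual_bases fdW.
exists [seq tcoord e' M j (f (b i)) | j <- enum 'I_n, i <- enum 'I_d].
move=> N h [fdN hh inj_h h_r].
apply: (@lift_ghom _ _ _ S (gtensor W N) (gtensor W M) (tmap idfun h)) => //.
- exact: (@ghom_tmap _ _ _ W W N M idfun h).
- exact: tmap_inj.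
move=> s; apply: (tcoord_lift ee') => j.
have /choice[u hu] : forall i, exists u, h u = tcoord e' M j (f (b i)).
  move=> i; apply: h_r; apply/allpairsP; exists (j, i).
  by rewrite !mem_enum.
exists (\sum_i (b' i s : k) *: u i).
rewrite [s in RHS](proj1 bb') !linear_sum; apply: eq_bigr => i _.
by rewrite !linearZ hu.
Qed.

End FiniteDimensionalSubmodules.

(** * Tensor products with direct sums *)

Section TensorDirectSum.
Variables (k : fieldType) (gT : finGroupType) (G : {group gT}).
Variables (I : choiceType) (W : gmod k G) (N : I -> gmod k G).

Let WN i := gtensor W (N i).

Definition tmul_dsum (u : W) (x : gdsum N) : gdsum WN :=
  dsum_map (fun i => mklin (tmulPr u) : {linear N i -> WN i}) x.

Lemma tmul_dsum_linl x : linear (fun u => tmul_dsum u x).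
Proof. by move=> a u v; apply: dsum_ext => i; exact: tmulPl. Qed.

Lemma tmul_dsum_linr u : linear (tmul_dsum u).
Proof. by move=> a x y; apply: dsum_ext => i; exact: tmulPr. Qed.

Definition tensor_dsum : {linear gtensor W (gdsum N) -> gdsum WN} :=
  tlift tmul_dsum_linl tmul_dsum_linr.

Lemma tensor_dsumE u x : tensor_dsum (tmul u x) = tmul_dsum u x.
Proof. exact: tliftE. Qed.

Lemma ghom_tensor_dsum : ghom tensor_dsum.
Proof.
move=> g Gg.
pose a := gact (gtensor W (gdsum N)) g; pose b := gact (gdsum WN) g.
apply: (tensor_ext (f := tensor_dsum \o a) (g := b \o tensor_dsum)) => u x /=.
rewrite tmapE [LHS]tensor_dsumE [X in _ = _ X]tensor_dsumE.
apply: dsum_ext => i.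
by apply/esym; exact: tmapE.
Qed.

Lemma dlift_tensor_dsum (M : gmod k G) (h : forall i, {linear N i -> M}) t :
  @dlift k I WN (gtensor W M) (fun i => tmap idfun (h i)) (tensor_dsum t) =
  tmap idfun (@dlift k I N M h) t.
Proof.
move: t; apply: (tensor_ext
  (f := @dlift k I WN (gtensor W M) (fun i => tmap idfun (h i)) \o tensor_dsum)
  (g := tmap idfun (@dlift k I N M h))) => u x /=.
rewrite tensor_dsumE tmapE.
rewrite -[RHS]/(mklin (tmulPr u) (@dlift k I N M h x)).
rewrite -(@dlift_comp _ _ _ _ _ h _ (fun i => mklin (tmulPr u) \o h i)) //.
rewrite -![dlift _ _]/(dlift_fun _ _) (@dlift_widen _ _ _ _ _ (dsupp x)).
  by apply: eq_fsbigr => i _; exact: tmapE.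
by move=> i /= nz xi; apply: nz; rewrite -[LHS]/(tmul u (dcoord x i)) xi tmul0r.
Qed.

End TensorDirectSum.

(** * Failure of generation *)

Theorem theorem3p4 (k : fieldType) (p q m : nat) (gT : finGroupType)
    (G H C : {group gT}) (M : gmod k H) (w : gmod k G)
    (char_k : p \in [pchar k])
    (q_gt1 : (1 < q)%N) (q_def : q = (p ^ m)%N)
    (pH : (p.-group H)%g) (repH : ~ finite_rep_type k H)
    (cycC : cyclic C) (cardC : #|C| = q)
    (defG : (H \x C)%g = G)
    (indM : indecomposable M) (dimM : countable_dim M)
    (fin_w : findim w)
    (vtx_w : exists Q : {group gT}, is_vertex w Q /\ conj_sub G Q H)
    (not_pp : ~ pure_projective (gtensor (gres (dprod_subl defG) w) M)) :
  ~ stmod_generates_StMod w.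
Proof.
move=> gen; apply: not_pp; set W := gres _ w.
have fdW : findim W by [].
have /choice[N NP] := @exists_fd_submodule k gT H M.
pose h r := projT1 (cid (NP r)).
have hP r : fd_submodule r (h r) := projT2 (cid (NP r)).
have fdN r : findim (N r) by case: (hP r).
have hh r : ghom (h r) by case: (hP r).
pose B := gdsum N; pose pi : {linear B -> M} := @dlift k (seq M) N M h.
have hpi : ghom pi by exact: ghom_dlift.
pose V := gtensor W B; pose U := gtensor W M.
pose p1 : {linear V -> U} := tmap idfun pi.
have hid : @ghom _ _ _ W W idfun by [].
have hp1 : ghom p1 := ghom_tmap hid hpi.
have lift_p1 (S : gmod k H) (g : {linear S -> U}) : findim S -> ghom g ->
    exists2 f : {linear S -> V}, ghom f & forall s, p1 (f s) = g s.
  move=> fdS hg; have [r rP] := tensor_factor_fd fdW fdS hg.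
  have [f hf fE] := rP _ _ (hP r).
  pose j : {linear gtensor W (N r) -> V} := tmap idfun (@din k (seq M) N r).
  have hj : ghom j := ghom_tmap hid (@ghom_din k gT H (seq M) N r).
  exists (j \o f); first exact: ghom_comp hf hj.
  by move=> s; rewrite -fE; apply: tmap_comp => // v; exact: dlift_in.
pose A := gker hpi; pose K := gtensor W A.
pose i1 : {linear K -> V} := tmap idfun (ker_incl pi).
have hi1 : ghom i1 := ghom_tmap hid (@ghom_ker_incl _ _ _ _ _ _ hpi).
have /cyclicP[c0 defC] := cycC.
have [c cE] : exists c : [subg C], sgval c = c0.
  by exists (subg C c0); rewrite subgK // defC cycle_id.
have c_gen (x : [subg C]) : exists j, x = (c ^+ j)%g.
  have : sgval x \in <[c0]>%g by rewrite -defC subgP.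
  case/cycleP => j xj; exists j; apply: subg_inj; rewrite xj -cE.
  by elim: j {xj} => // j IHj; rewrite !expgS IHj.
have C0 : #|C|%:R = 0 :> k.
  apply/eqP; rewrite -(dvdn_pcharf char_k) cardC q_def.
  by case: m q_def => [|m'] qE; [rewrite qE in q_gt1 | rewrite dvdn_exp].
have [f [g [_ _ [P [wP [a [b [ha hb abE]]]]] _]]] :
    stable_iso w (ext defG hp1 c) (gzero k G).
  apply: gen => S fdS f hf.
  have [|||||a [b [ha hb fE]]] :=
    @ext_factor _ _ _ _ _ defG _ _ _ hp1 c K i1 S f hi1.
  - exact: tmap_inj fdW (@ker_incl_inj _ _ _ pi).
  - move=> t; rewrite -(@tmap_0r _ _ _ _ _ (@idfun W) \0 t) //.
    by apply: tmap_comp => // v; exact: ker_inclK.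
  - by move=> t; apply: tmap_exact => // v; exact: ker_incl_surj.
  - by move=> g; exact: (lift_p1 (gres (dprod_subl defG) S) g fdS).
  - by [].
  exists (coind defG (gsum2 K V)); split.
    exact/wproj_coind/gsummand_tensor_gsum2.
  by exists a, b; split=> // s; rewrite subr0.
(* E being isomorphic to 0, the identity of E is - b \o a. *)
have hE : higman defG (ext defG hp1 c).
  apply: (@higman_retract _ _ _ _ _ _ P _ a (\- b)) => //.
  - move=> x Gx v; rewrite -[LHS]/(- b (gact P x v)) hb //.
    by rewrite -[RHS]/(gact (ext defG hp1 c) x (- b v)) linearN.
  - move=> v; rewrite -[LHS]/(- b (a v)) -abE.
    have -> : (g \o f) v = 0 by rewrite /= [f v]thinmx0 linear0.
    by rewrite sub0r opprK.
  - exact: higman_wproj (higman_vertex defG vtx_w) wP.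
have [s hs sK] := ext_split c_gen C0 hE.
exists (seq M), (fun r => gtensor W (N r)).
split=> [r|]; first exact: findim_tensor.
pose lift1 r : {linear gtensor W (N r) -> U} := tmap idfun (h r).
apply: (@gsummand_retract _ _ _ _ _ (tensor_dsum W N \o s)
  (@dlift k (seq M) (fun r => gtensor W (N r)) U lift1)).
- exact: ghom_comp hs (@ghom_tensor_dsum _ _ _ _ W N).
- by apply: ghom_dlift => r; exact: ghom_tmap.
- by move=> u; exact: etrans (dlift_tensor_dsum h (s u)) (sK u).
Qed.
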